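(* Fix $d,m\in\mathbb{N}$, let $n=d+m$, let $K\subset\mathbb{R}^d$ be a closed rectangle, let $f=(f_1,\dots,f_m):K\to\mathbb{R}^m$ be of class $C^2$, and let $M=\{(\alpha,f(\alpha)):\alpha\in K\}\subset\mathbb{R}^n$. Let $g$ be a dimension function such that $\bar g(\rho):=g(\rho)/\rho^m$ is increasing, and suppose that for some $k\in\mathbb{N}$ both of the following hold: (I) the series \[ \sum_{q=1}^\infty q^n\, g\!\left(q^{-1}\big(q^{-1}\log^2(q)\big)^{\frac{k}{2m+k}}\right) \] converges; (II) for $\mathcal{H}^{\bar g}$-a.e. $\alpha\in K$, \[ \operatorname{rank}\big(t\cdot f''(\alpha)[e_i,e_j]\big)_{1\le i,j\le d}\ \ge k\quad\text{for all } t\in\mathbb{R}^m\setminus\{0\}. \] Then $M$ is of strong Jarník type for convergence with respect to $g$; that is, for every function $\psi:\mathbb{N}\to\mathbb{R}_{>0}$ such that $\sum_{q=1}^\infty q^n g(\psi(q)/q)<\infty$ and every $\theta\in\mathbb{R}^n$, we have $\mathcal{H}^{\bar g}(S(\psi,\theta)\cap M)=0$.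
   Context: A dimension function is a nondecreasing continuous function $g$ with $\lim_{\rho\to0}g(\rho)=0$; $\mathcal{H}^g$ denotes Hausdorff measure with gauge function $g$. $(e_i)$ is the standard basis of $\mathbb{R}^d$; $f''(\alpha)[e_i,e_j]=\big(\partial^2 f_l/\partial\alpha_i\partial\alpha_j(\alpha)\big)_{l=1}^m$, and $t\cdot(\cdot)$ is the dot product in $\mathbb{R}^m$. For $x\in\mathbb{R}^n$, $\|x\|$ is the max-norm distance from $x$ to $\mathbb{Z}^n$. For $\psi:\mathbb{N}\to\mathbb{R}_{>0}$ and $\theta\in\mathbb{R}^n$, $S(\psi,\theta)=\{x\in\mathbb{R}^n:\|qx-\theta\|<\psi(q)\text{ for infinitely many }q\in\mathbb{N}\}$. *)

(* Defs.v *)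
From mathcomp Require Export all_boot all_order all_algebra.
From mathcomp Require Export all_classical all_reals all_analysis.

Set Implicit Arguments.
Unset Strict Implicit.
Unset Printing Implicit Defensive.

Export Order.TTheory GRing.Theory Num.Theory.
Export numFieldNormedType.Exports.

Local Open Scope classical_set_scope.
Local Open Scope ring_scope.

Section Hausdorff.
Context {R : realType} {V : normedModType R}.

Definition diam (A : set V) : \bar R :=
  ereal_sup [set r | exists x y, [/\ A x, A y & r = `|x - y|%:E]].

(* The gauge of a nonempty set of diameter 0 is the right limit g(0+), so that
   the measure only depends on the values of g on ]0, +oo[. Gauges are applied
   only to sets of diameter at most delta < +oo, so [fine] loses nothing. *)
Definition gauge_diam (g : R -> R) (A : set V) : \bar R :=
  if A == set0 then 0%E
  else if diam A == 0%E then (lim (g r @[r --> 0^'+]))%:E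
  else (g (fine (diam A)))%:E.

Definition hausdorff_premeasure (g : R -> R) (delta : R) (A : set V) : \bar R :=
  ereal_inf [set s | exists U : nat -> set V,
    [/\ A `<=` \bigcup_i U i,
        forall i, (diam (U i) <= delta%:E)%E &
        s = (\sum_(0 <= i <oo) gauge_diam g (U i))%E]].

Definition hausdorff_measure (g : R -> R) (A : set V) : \bar R :=
  ereal_sup [set hausdorff_premeasure g delta A | delta in [set r | 0 < r]].

End Hausdorff.

Section Gauges.
Context {R : realType}.

Definition dimension_function (g : R -> R) : Prop :=
  [/\ {in `[0, +oo[ &, {homo g : x y / x <= y}},
      {within `[0, +oo[, continuous g} &
      g r @[r --> 0^'+] --> 0].

Definition gbar (m : nat) (g : R -> R) (r : R) : R := g r / r ^+ m.

End Gauges.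

Section Rectangle.
Context {R : realType} {d : nat}.
Implicit Types (K : set 'rV[R]_d) (F : 'rV[R]_d -> R).

Definition rectangle (a b : 'rV[R]_d) : set 'rV[R]_d :=
  [set x | forall i, a 0 i <= x 0 i <= b 0 i].

(* Partial derivatives relative to K: the increment is restricted to points of
   K, so they are two-sided inside a rectangle K and one-sided on its faces, and
   only the values of F on K are used. *)
Definition pquot F (i : 'I_d) (x : 'rV[R]_d) (h : R) : R :=
  h^-1 * (F (x + h *: delta_mx 0 i) - F x).

Definition pfilter K (i : 'I_d) (x : 'rV[R]_d) : set_system R :=
  within [set h | K (x + h *: delta_mx 0 i)] 0^'.

Definition pderivable K (i : 'I_d) F (x : 'rV[R]_d) : Prop :=
  cvg (pquot F i x @ pfilter K i x).

Definition partial K (i : 'I_d) F (x : 'rV[R]_d) : R :=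
  lim (pquot F i x @ pfilter K i x).

Definition C1_on K F : Prop :=
  {within K, continuous F} /\
  forall i, (forall x, K x -> pderivable K i F x) /\
            {within K, continuous (partial K i F)}.

Definition C2_on K F : Prop :=
  C1_on K F /\ forall i, C1_on K (partial K i F).

Definition C2_map m K (f : 'rV[R]_d -> 'rV[R]_m) : Prop :=
  forall l, C2_on K (fun x => f x 0 l).

(* f''(x)[e_i, e_j] *)
Definition second_deriv m K (f : 'rV[R]_d -> 'rV[R]_m) (x : 'rV[R]_d)
    (i j : 'I_d) : 'rV[R]_m :=
  \row_l partial K i (partial K j (fun y => f y 0 l)) x.

Definition dot m (u v : 'rV[R]_m) : R := \sum_l u 0 l * v 0 l.

Definition graph_on m K (f : 'rV[R]_d -> 'rV[R]_m) : set 'rV[R]_(d + m) :=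
  [set row_mx x (f x) | x in K].

End Rectangle.

Section Approximation.
Context {R : realType} {n : nat}.

(* The norm of the library on 'rV[R]_n is the max norm. *)
Definition dist_int (x : 'rV[R]_n) : R :=
  inf [set `|x - map_mx intr p| | p in [set: 'rV[int]_n]].

Definition well_approximable (psi : nat -> R) (theta : 'rV[R]_n) :
    set 'rV[R]_n :=
  [set x | infinite_set
     [set q : nat | (0 < q)%N /\ dist_int (q%:R *: x - theta) < psi q]].

(* m is the codimension of the manifold M in R^n *)
Definition strong_jarnik_convergence (m : nat) (g : R -> R)
    (M : set 'rV[R]_n) : Prop :=
  forall psi : nat -> R,
    (forall q, (0 < q)%N -> 0 < psi q) ->
    (\sum_(1 <= q <oo) (q%:R ^+ n * g (psi q / q%:R))%:E < +oo)%E ->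
    forall theta : 'rV[R]_n,
      hausdorff_measure (gbar m g) (well_approximable psi theta `&` M) = 0%E.

End Approximation.

(* Main.v *)
(* By Borel-Cantelli it suffices to cover, for each large q, the points alpha
   near a point where (II) holds with ||q (alpha, f alpha) - theta|| < delta by
   O(q^d delta^m) sets of diameter at most delta / q. Here psi(q) may be enlarged
   to the function in (I), so that delta^(2m+k) q^k >= 1.

   Cut the integer points p with q alpha close to p + theta into boxes of side
   L ~ sqrt(delta q). On such a box q f is affine up to an error O(delta), so the
   number of admissible points is controlled by the linear system
   ||y + f'(alpha) v|| < delta with v in [0, L)^d. Expanding with frequencies
   t in Z^m, |t| <= T ~ 1/delta, and Fejer kernels D of order 2L, this number is
   at most a constant times L^-d T^-2m sum_(j, j') prod_i D((j - j').d_i f(alpha)).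
   The diagonal terms give the main term. For t = j - j' <> 0 the rank condition
   makes alpha |-> t.f'(alpha) expanding, with factor of order |t|, in k suitable
   coordinates, so the vectors t.f'(alpha) at the different boxes are well spaced
   modulo 1 in these directions, and the average over the boxes of the product
   of Fejer kernels is smaller than its maximum by a factor L^-k. The choice of
   L and the lower bound for delta give L^-k <= delta^m. *)

Require Import Defs.
From mathcomp Require Import ring lra zify.
From mathcomp Require Import complex.

Set Implicit Arguments.
Unset Strict Implicit.
Unset Printing Implicit Defensive.

Local Open Scope classical_set_scope.
Local Open Scope ring_scope.

(** * Hausdorff-null sets *)

(** The scale L is forced: over a box of side L the quadratic error of q f is of order q (L / q)^2,
    so L ~ sqrt(delta q) is the largest side that keeps it O(delta). The T^m diagonal pairs
    contribute about q^d T^-m ~ q^d delta^m, the others about q^d L^-k. The latter is absorbed when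
    L^-k <= delta^m, that is when delta^(2m+k) q^k >= 1; this is the source of the exponent k /
    (2m+k) in (I).

    The gain of L per direction does not depend on t: t.f' runs through about |t| unit intervals,
    and in each of them a window of length 1 / (2L) confines the box index to about q / (L^2 |t|)
    values, hence to about q / L^2 out of q / L altogether. This needs L^2 |t| = O(q), which holds
    since |t| <= T ~ 1 / delta.

    The constants of the expansion depend on the point alpha and may degenerate near the exceptional
    set of (II). As null sets are stable under countable unions, the count is made separately on the
    cubes of a countable family, each with its own constants. *)

Definition monotone_gauge (R : realType) (h : R -> R) : Prop :=
  [/\ 0 <= h 0, forall r, 0 < r -> 0 <= h r &
      forall r s, 0 < r -> r <= s -> h r <= h s].

(** The vanishing of [hausdorff_measure] with its supremum and infimum unfolded into explicit
    covers; [hausdorff_measure_eq0] gives the equivalence. *)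
Definition gauge_null (R : realType) (V : normedModType R) (h : R -> R)
    (A : set V) : Prop :=
  forall delta eps : R, 0 < delta -> 0 < eps -> exists U : nat -> set V,
    [/\ A `<=` \bigcup_i U i, forall i, (diam (U i) <= delta%:E)%E &
        (\sum_(0 <= i <oo) gauge_diam h (U i) <= eps%:E)%E].

Lemma diam_leP (R : realType) (V : normedModType R) (A : set V) (r : R) :
  (diam A <= r%:E)%E <-> forall x y, A x -> A y -> `|x - y| <= r.
Proof.
split=> [Ar x y Ax Ay|Ar].
  rewrite -lee_fin (le_trans _ Ar)//; apply: ereal_sup_ubound.
  by exists x, y.
by apply: ge_ereal_sup => _ [x [y [Ax Ay ->]]]; rewrite lee_fin Ar.
Qed.

Lemma diam_ge0 (R : realType) (V : normedModType R) (A : set V) :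
  A !=set0 -> (0 <= diam A)%E.
Proof.
move=> [x Ax]; apply: ereal_sup_ubound; exists x, x.
by rewrite subrr normr0.
Qed.

Lemma diam_le (R : realType) (V : normedModType R) (A B : set V) :
  A `<=` B -> (diam A <= diam B)%E.
Proof.
move=> AB; apply: ge_ereal_sup => _ [x [y [Ax Ay ->]]].
by apply: ereal_sup_ubound; exists x, y; split => //; exact: AB.
Qed.

Lemma gauge_diam0 (R : realType) (V : normedModType R) (h : R -> R) :
  gauge_diam h (set0 : set V) = 0%E.
Proof. by rewrite /gauge_diam eqxx. Qed.

Lemma monotone_gauge_cvg (R : realType) (h : R -> R) : monotone_gauge h ->
  cvg (h r @[r --> 0^'+]).
Proof.
move=> [_ h0 hle]; apply: nondecreasing_at_right_is_cvgr; near=> x.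
  move=> y z; rewrite !in_itv/= => /andP[y0 _] _ yz; exact: hle.
by exists 0 => _ [y /=] /[!in_itv]/= /andP[y0 _] <-; exact: h0.
Unshelve. all: by end_near. Qed.

Lemma lim_gauge_le (R : realType) (h : R -> R) (r : R) : monotone_gauge h ->
  0 < r -> lim (h s @[s --> 0^'+]) <= h r.
Proof.
move=> hh r0; have := hh => -[_ h0 hle].
apply: limr_le; first exact: monotone_gauge_cvg.
near=> s; apply: hle; near: s.
  exact: nbhs_right_gt.
exact: nbhs_right_le.
Unshelve. all: by end_near. Qed.

Lemma lim_gauge_ge0 (R : realType) (h : R -> R) : monotone_gauge h ->
  0 <= lim (h s @[s --> 0^'+]).
Proof.
move=> hh; have := hh => -[_ h0 hle].
apply: limr_ge; first exact: monotone_gauge_cvg.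
by near=> s; apply: h0; near: s; exact: nbhs_right_gt.
Unshelve. all: by end_near. Qed.

Lemma gauge_diam_ge0 (R : realType) (V : normedModType R) (h : R -> R)
    (A : set V) : monotone_gauge h -> (0 <= gauge_diam h A)%E.
Proof.
move=> hh; have := hh => -[h00 h0 hle]; rewrite /gauge_diam.
case: eqVneq => // /set0P/diam_ge0 dA; case: eqVneq => dA0.
  by rewrite lee_fin lim_gauge_ge0.
(* Infinite diameter is settled by [0 <= h 0], because [fine] sends +oo to 0. *)
rewrite lee_fin; move: dA dA0; case: (diam A) => //= r.
by rewrite lee_fin eqe => r0 rN0; rewrite h0// lt_def rN0 r0.
Qed.

Lemma gauge_diam_le (R : realType) (V : normedModType R) (h : R -> R)
    (A : set V) (r : R) : monotone_gauge h -> 0 < r -> (diam A <= r%:E)%E ->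
  (gauge_diam h A <= (h r)%:E)%E.
Proof.
move=> hh r0 Ar; have := hh => -[h00 h0 hle]; rewrite /gauge_diam.
case: eqVneq => [_|/set0P/diam_ge0 dA]; first by rewrite lee_fin h0.
case: eqVneq => dA0; first by rewrite lee_fin lim_gauge_le.
rewrite lee_fin; move: dA dA0 Ar; case: (diam A) => //= s.
by rewrite !lee_fin eqe => s0 sN0 sr; rewrite hle// lt_def sN0 s0.
Qed.

(** The two sets may lie in different spaces: the image of a set under a Lipschitz map is compared
    with a set of its source. *)
Lemma gauge_diam_mono (R : realType) (V W : normedModType R) (h : R -> R)
    (A : set V) (B : set W) : monotone_gauge h -> (A !=set0 -> B !=set0) ->
  (diam A <= diam B)%E -> (diam B < +oo)%E ->
  (gauge_diam h A <= gauge_diam h B)%E.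
Proof.
move=> hh AB0 AB Boo; have := hh => -[h00 h0 hle].
have [->|/set0P A0] := eqVneq A set0.
  by rewrite gauge_diam0 gauge_diam_ge0.
have /diam_ge0 dB := AB0 A0; have /diam_ge0 dA := A0.
move: A0 => /set0P/negbTE A0; have {}AB0 : (B == set0) = false.
  by apply/negbTE/set0P/AB0/set0P; rewrite A0.
rewrite /gauge_diam A0 AB0; move: dA dB AB Boo.
case: (diam A) (diam B) => [r| |] [s| |]//=; rewrite !lee_fin !eqe => r0 s0 rs _.
case: eqVneq => rr0; case: eqVneq => ss0; rewrite lee_fin//.
- by rewrite lim_gauge_le// lt_def ss0 s0.
- by exfalso; move/eqP: rr0; apply; apply/eqP; rewrite eq_le r0 -ss0 rs.
- by rewrite hle// lt_def rr0 r0.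
Qed.

Lemma hausdorff_measure_eq0 (R : realType) (V : normedModType R) (h : R -> R)
    (A : set V) : monotone_gauge h ->
  hausdorff_measure h A = 0%E <-> gauge_null h A.
Proof.
move=> hh.
have pre_ge0 delta : (0 <= hausdorff_premeasure h delta A)%E.
  apply: le_ereal_inf_tmp => _ [U [_ _ ->]].
  by apply: nneseries_ge0 => n _ _; exact: gauge_diam_ge0.
split=> [A0 delta eps delta0 eps0|An].
  have : (hausdorff_premeasure h delta A < eps%:E)%E.
    rewrite (@le_lt_trans _ _ 0%E) ?lte_fin// -A0.
    by apply: ereal_sup_ubound; exists delta.
  move=> /ereal_inf_lt[_ [U [AU Ud ->]] /ltW Ueps].
  by exists U.
apply/eqP; rewrite eq_le; apply/andP; split; last first.
  rewrite (le_trans (pre_ge0 1))//; apply: ereal_sup_ubound.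
  by exists 1 => //=.
apply: ge_ereal_sup => _ [delta /= delta0 <-].
apply/lee_addgt0Pr => eps eps0; rewrite add0e.
have [U [AU Ud Ue]] := An _ _ delta0 eps0.
by apply: le_trans Ue; apply: ereal_inf_lbound; exists U.
Qed.

(** Flattens a doubly indexed cover. Nonnegative series are sums over index sets, which do not
    depend on the order of summation. *)
Lemma nneseries_pair (R : realType) (a : nat -> nat -> \bar R) :
  (forall i j, 0 <= a i j)%E ->
  exists2 e : nat -> nat * nat, set_bij setT setT e &
  (\sum_(0 <= n <oo) a (e n).1 (e n).2 =
   \sum_(0 <= i <oo) \sum_(0 <= j <oo) a i j)%E.
Proof.
move=> a0; have /card_esym/ppcard_eqP[e] := card_nat2.
exists e; first exact: bij.
rewrite nneseries_esumT//.
rewrite -(@reindex_esum _ _ _ setT setT e (fun p => a p.1 p.2))//.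
rewrite nneseries_esumT; last by move=> i; exact: nneseries_ge0.
have -> : [set: nat * nat] = [set: nat] `*`` (fun=> [set: nat]).
  by apply/seteqP; split.
rewrite -(@esum_esum _ _ _ setT (fun=> setT) a)//.
by apply: eq_esum => i _; rewrite nneseries_esumT.
Qed.

Lemma gauge_null_double (R : realType) (V : normedModType R) (h : R -> R)
    (A : set V) : monotone_gauge h ->
  (forall delta eps : R, 0 < delta -> 0 < eps ->
     exists U : nat -> nat -> set V,
     [/\ A `<=` \bigcup_i \bigcup_j U i j,
       forall i j, (diam (U i j) <= delta%:E)%E &
       (\sum_(0 <= i <oo) \sum_(0 <= j <oo) gauge_diam h (U i j) <= eps%:E)%E]) ->
  gauge_null h A.
Proof.
move=> hh H delta eps delta0 eps0; have [U [AU Ud Ue]] := H _ _ delta0 eps0.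
have [e [_ _ esurj] se] := nneseries_pair (fun i j => gauge_diam_ge0 (U i j) hh).
exists (fun n => U (e n).1 (e n).2); split; last by rewrite se.
- move=> x /AU[i _ [j _ Ux]]; have [n _ en] := esurj (i, j) I.
  by exists n; rewrite // en.
- by move=> n; exact: Ud.
Qed.

Lemma gauge_null_sub (R : realType) (V : normedModType R) (h : R -> R)
    (A B : set V) : A `<=` B -> gauge_null h B -> gauge_null h A.
Proof.
move=> AB Bn delta eps delta0 eps0; have [U [BU Ud Ue]] := Bn _ _ delta0 eps0.
by exists U; split=> // x /AB/BU.
Qed.

Lemma gauge_null0 (R : realType) (V : normedModType R) (h : R -> R) :
  gauge_null h (set0 : set V).
Proof.
move=> delta eps delta0 eps0; exists (fun=> set0); split=> // [i|].
  by apply/diam_leP.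
by rewrite eseries0 ?lee_fin ?ltW// => i _ _; rewrite gauge_diam0.
Qed.

Lemma gauge_null_bigcup (R : realType) (V : normedModType R) (h : R -> R)
    (A : nat -> set V) : monotone_gauge h ->
  (forall i, gauge_null h (A i)) -> gauge_null h (\bigcup_i A i).
Proof.
move=> hh An; apply: gauge_null_double => // delta eps delta0 eps0.
have H i : exists U : nat -> set V, [/\ A i `<=` \bigcup_i U i,
      forall i, (diam (U i) <= delta%:E)%E &
      (\sum_(0 <= i <oo) gauge_diam h (U i) <= (eps / (2 ^ i.+1)%:R)%:E)%E].
  by apply: An; rewrite // divr_gt0// ltr0n expn_gt0.
have [U HU] := choice H; exists U; split.
- move=> x [i _ Aix]; have [+ _ _] := HU i => /(_ _ Aix)[j _ Ux].
  by exists i => //; exists j.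
- by move=> i j; have [_ + _] := HU i; exact.
- apply: le_trans (epsilon_trick0 xpredT (ltW eps0)).
  apply: lee_nneseries => i _; last by have [_ _ +] := HU i; exact.
  by move=> _; apply: nneseries_ge0 => j _ _; exact: gauge_diam_ge0.
Qed.

Lemma gauge_null_setU (R : realType) (V : normedModType R) (h : R -> R)
    (A B : set V) : monotone_gauge h ->
  gauge_null h A -> gauge_null h B -> gauge_null h (A `|` B).
Proof.
move=> hh An Bn.
apply: (@gauge_null_sub _ _ _ _ (\bigcup_i (if i is 0%N then A else B))).
  by move=> x [Ax|Bx]; [exists 0%N|exists 1%N].
by apply: gauge_null_bigcup => // -[].
Qed.

Lemma rV_norm_leP (R : realType) n (x : 'rV[R]_n) (r : R) : 0 <= r ->
  `|x| <= r <-> forall i, `|x 0 i| <= r.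
Proof.
move=> r0.
have -> : `|x| = \big[Num.max/0]_ij `|x ij.1 ij.2|.
  by rewrite [LHS]/Num.norm /= mx_normrE.
split.
  by move=> /bigmax_leP[_ H] i; exact: (H (0, i)).
by move=> H; apply/bigmax_leP; split => // -[i j] _ /=; rewrite ord1.
Qed.

Lemma coord_le_norm (R : realType) n (x : 'rV[R]_n) i : `|x 0 i| <= `|x|.
Proof. by move: i; apply/rV_norm_leP. Qed.

Lemma rV_norm_lt (R : realType) n (x : 'rV[R]_n) (r : R) : `|x| < r ->
  forall i, `|x 0 i| < r.
Proof. by move=> xr i; exact: le_lt_trans (coord_le_norm _ _) xr. Qed.

(* The gauge is not assumed doubling: where a diameter grows by a factor M, the
   set is cut beforehand into boundedly many pieces of diameter D / M. *)
Lemma diam_split (R : realType) (d M : nat) : (0 < M)%N ->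
  exists N : nat, forall (A : set 'rV[R]_d) (D : R), (diam A <= D%:E)%E ->
  exists P : nat -> set 'rV[R]_d,
    [/\ A `<=` \bigcup_j P j, forall j, P j `<=` A,
        forall j, (N <= j)%N -> P j = set0 &
        forall j, (diam (P j) <= (D / M%:R)%:E)%E].
Proof.
move=> M0; pose I := {ffun 'I_d -> 'I_(2 * M).+1}; exists #|{: I}| => A D AD.
have [->|/set0P[x0 Ax0]] := eqVneq A set0.
  by exists (fun=> set0); split => [x []|j x []|//|j]; apply/diam_leP.
have D0 : 0 <= D.
  by move/diam_leP: AD => /(_ _ _ Ax0 Ax0); apply: le_trans.
(* Each coordinate lies in [x0 - D, x0 + D], which is cut into steps of length D / M. The right end
   point has index 2 * M, hence 2 * M + 1 indices. *)
pose c (x : 'rV[R]_d) : I := [ffun i =>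
  inord (Num.truncn ((x 0 i - x0 0 i + D) / D * M%:R))].
pose P j := [set x | A x /\ enum_rank (c x) = j :> nat].
exists P; split.
- by move=> x Ax; exists (enum_rank (c x)) => //.
- by move=> j x [].
- move=> j Nj; apply/seteqP; split=> // x [_ /esym jE].
  by move: Nj; rewrite jE leqNgt ltn_ord.
move=> j; apply/diam_leP => x y [Ax xj] [Ay yj].
apply/rV_norm_leP => [|i]; first by rewrite divr_ge0.
have /ffunP/(_ i) : c x = c y.
  by apply: enum_rank_inj; apply: val_inj; rewrite /= xj yj.
rewrite !ffunE => /(congr1 (@nat_of_ord _)).
have [D00|DN0] := eqVneq D 0.
  move=> _; rewrite D00 mul0r -D00 (le_trans (coord_le_norm (x - y) i))//.
  by move/diam_leP: AD; apply.
have {DN0}D0 : 0 < D by rewrite lt_def DN0.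
have bd z : A z -> 0 <= (z 0 i - x0 0 i + D) / D * M%:R <= 2 * M%:R.
  move=> Az; have : `|z 0 i - x0 0 i| <= D.
    move/diam_leP: AD => /(_ _ _ Az Ax0); apply: le_trans.
    by have := coord_le_norm (z - x0) i; rewrite !mxE.
  rewrite ler_norml => /andP[z1 z2].
  rewrite mulr_ge0 ?divr_ge0//; [|lra..]; rewrite ler_wpM2r//.
  by rewrite ler_pdivrMr//; lra.
have tr z : A z -> (Num.truncn ((z 0 i - x0 0 i + D) / D * M%:R)%R < (2 * M).+1)%N.
  move=> /bd/andP[z0 z2]; rewrite ltnS -(ler_nat R) natrM.
  by rewrite (le_trans _ z2)// truncn_le.
rewrite !inordK ?tr//.
move: (bd _ Ax) (bd _ Ay) => /andP[x1 _] /andP[y1 _].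
have /andP[x2 x3] := truncn_itv x1; have /andP[y2 y3] := truncn_itv y1.
move=> e; rewrite e in x2 x3; rewrite !mxE.
set u := (x 0 i - _ + _) / D * _ in x2 x3; set v := _ / D * _ in y2 y3.
have -> : x 0 i - y 0 i = (u - v) * (D / M%:R).
  have MN : M%:R != 0 :> R by rewrite pnatr_eq0 -lt0n.
  by rewrite /u /v; field; rewrite MN lt0r_neq0.
have DM : 0 < D / M%:R by rewrite divr_gt0// ltr0n.
rewrite normrM (gtr0_norm DM) ger_pMl// ler_norml.
by move: x2 x3 y2 y3; rewrite -natr1 => *; apply/andP; split; lra.
Qed.

Lemma nneseries_finite_le (R : realType) (a : nat -> \bar R) (N : nat) (c : R) :
  (forall j, (0 <= a j)%E) -> (forall j, (j < N)%N -> (a j <= c%:E)%E) ->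
  (forall j, (N <= j)%N -> a j = 0%E) ->
  (\sum_(0 <= j <oo) a j <= (N%:R * c)%:E)%E.
Proof.
move=> a0 ac aN; rewrite (nneseries_split 0%N N)// add0n (@eseries0 _ _ N)//; last first.
  by move=> j Nj _; exact: aN.
rewrite adde0.
rewrite (@le_trans _ _ (\sum_(0 <= j < N) c%:E)%E)//.
  by rewrite !big_nat; apply: lee_sum => j /andP[_ jN]; exact: ac.
by rewrite sumEFin big_const_nat subn0 iter_addr_0 mulr_natl.
Qed.

Lemma gauge_null_lipschitz (R : realType) (d : nat) (V : normedModType R)
    (h : R -> R) (A : set 'rV[R]_d) (F : 'rV[R]_d -> V) (M : nat) :
  monotone_gauge h -> (0 < M)%N ->
  (forall x y, A x -> A y -> `|F x - F y| <= M%:R * `|x - y|) ->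
  gauge_null h A -> gauge_null h (F @` A).
Proof.
move=> hh M0 FM An; apply: gauge_null_double => // delta eps delta0 eps0.
have [N HN] := @diam_split R d M M0.
(* Each set of the cover becomes [N] sets whose gauge is no larger, so the total grows by a factor
   [N]; the successor avoids a division by 0. *)
have eN : 0 < eps / N.+1%:R by rewrite divr_gt0.
have [U [AU Ud Ue]] := An _ _ delta0 eN.
have HP i : exists P : nat -> set 'rV[R]_d,
    [/\ A `&` U i `<=` \bigcup_j P j, forall j, P j `<=` A `&` U i,
        forall j, (N <= j)%N -> P j = set0 &
        forall j, (diam (F @` P j) <= diam (U i))%E].
  have [AU0|/set0P AU0] := eqVneq (A `&` U i) set0.
    exists (fun=> set0); split=> [|j x []|//|j]; first by rewrite AU0 => x [].
    rewrite /= image_set0 /diam; apply: ge_ereal_sup => _ [x [y [[] //]]].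
  have dd : (diam (A `&` U i) <= diam (U i))%E by apply: diam_le => x [].
  have := diam_ge0 AU0; move: dd (Ud i).
  case E : (diam (A `&` U i)) => [D| |]// dd _ D0; last first.
    by move: dd (Ud i); rewrite leye_eq => /eqP ->.
  have [|P [P1 P2 P3 P4]] := HN (A `&` U i) D; first by rewrite E.
  exists P; split => // j; apply: le_trans dd.
  apply/diam_leP => _ _ [x Px <-] [y Py <-].
  have [Ax _] := P2 _ _ Px; have [Ay _] := P2 _ _ Py.
  rewrite (le_trans (FM _ _ Ax Ay))//.
  move/diam_leP: (P4 j) => /(_ _ _ Px Py).
  by rewrite ler_pdivlMr ?ltr0n// mulrC.
have [P HP'] := choice HP; exists (fun i j => F @` P i j); split.
- move=> _ [x Ax <-]; have [i _ Ux] := AU _ Ax.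
  have [+ _ _ _] := HP' i => /(_ x (conj Ax Ux))[j _ Px].
  by exists i => //; exists j => //; exists x.
- by move=> i j; have [_ _ _ +] := HP' i => /(_ j)/le_trans; apply.
have g0 i := gauge_diam_ge0 (U i) hh.
apply: (@le_trans _ _ (\sum_(0 <= i <oo) (N%:R)%:E * gauge_diam h (U i))%E).
  apply: lee_nneseries => i _.
    by move=> _; apply: nneseries_ge0 => j _ _; exact: gauge_diam_ge0.
  have [P1 P2 P3 P4] := HP' i.
  have [r rE] : exists r, gauge_diam h (U i) = r%:E.
    by rewrite /gauge_diam; case: ifP => _; [|case: ifP => _]; eexists.
  rewrite rE -EFinM; apply: nneseries_finite_le => j.
  - exact: gauge_diam_ge0.
  - move=> _; rewrite -rE; apply: gauge_diam_mono => //.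
      by move=> [_ [x /P2[_ Ux] _]]; exists x.
    by rewrite (le_lt_trans (Ud i))// ltry.
  - by move=> Nj; rewrite P3// image_set0 gauge_diam0.
rewrite nneseriesZl; last by move=> *; exact: g0.
rewrite (@le_trans _ _ (N%:R%:E * (eps / N.+1%:R)%:E)%E)//.
  by rewrite lee_wpmul2l// lee_fin.
rewrite -EFinM lee_fin mulrCA ger_pMr// ler_pdivrMr ?ltr0n// mul1r.
by rewrite ler_nat.
Qed.

(** The convergence half of Borel-Cantelli: every tail of the sequence of finite families [s q]
    still covers [A], and the tails of a convergent series are small. *)
Lemma gauge_null_limsup (R : realType) (V : normedModType R) (h : R -> R)
    (A : set V) (s : nat -> seq (set V)) (r : nat -> R) :
  monotone_gauge h ->
  (forall x, A x -> forall Q, exists q, [/\ (Q <= q)%N & exists2 j,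
     (j < size (s q))%N & nth set0 (s q) j x]) ->
  (forall q, 0 < r q) ->
  (forall q j, (j < size (s q))%N -> (diam (nth set0 (s q) j) <= (r q)%:E)%E) ->
  r @ \oo --> 0 ->
  (\sum_(0 <= q <oo) ((size (s q))%:R * h (r q))%:E < +oo)%E ->
  gauge_null h A.
Proof.
move=> hh As r0 rd rc soo; apply: gauge_null_double => // delta eps delta0 eps0.
have [h00 h0 hle] := hh.
have f0 q : (0 <= ((size (s q))%:R * h (r q))%:E)%E.
  by rewrite lee_fin mulr_ge0 ?h0.
have /fine_cvgP[tf tc] := nneseries_tail_cvg soo (fun k _ => f0 k).
have rn : \forall n \near \oo, forall p, (n <= p)%N -> r p <= delta.
  have /cvgrPdist_le/(_ _ delta0)[n _ Hn] := rc.
  exists n => // n' /= nn' p n'p; have := Hn p (leq_trans nn' n'p).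
  by rewrite sub0r normrN; apply: le_trans; exact: ler_norm.
move/cvgrPdist_le : tc => /(_ _ eps0) tn.
near \oo => Q.
have Qr : forall q, (Q <= q)%N -> r q <= delta by near: Q.
have Qe : (\sum_(Q <= q <oo) ((size (s q))%:R * h (r q))%:E <= eps%:E)%E.
  rewrite -[leLHS]fineK; last by near: Q.
  rewrite lee_fin (le_trans (ler_norm _))//.
  by rewrite -normrN -[X in `|X|]add0r; near: Q.
exists (fun i j => if (Q <= i)%N then nth set0 (s i) j else set0); split.
- move=> x /As/(_ Q)[q [Qq [j jq qj]]].
  by exists q => //; exists j => //=; rewrite Qq.
- move=> i j; case: ifP => [Qi|_]; last by apply/diam_leP.
  have [js|js] := ltnP j (size (s i)).
    by rewrite (le_trans (rd _ _ js))// lee_fin Qr.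
  by rewrite nth_default//; apply/diam_leP.
apply: le_trans Qe.
rewrite (nneseries_split 0%N Q); last first.
  by move=> k _; apply: nneseries_ge0 => *; exact: gauge_diam_ge0.
rewrite add0n big_nat big1 ?add0e; last first.
  move=> i /andP[_ iQ]; apply: eseries0 => j _ _.
  by rewrite leqNgt iQ gauge_diam0.
rewrite [leLHS]eseries_cond [leRHS]eseries_cond.
apply: lee_nneseries => i Qi.
  by move=> _; apply: nneseries_ge0 => *; exact: gauge_diam_ge0.
rewrite /= in Qi; rewrite Qi.
apply: nneseries_finite_le => j; first exact: gauge_diam_ge0.
  by move=> js; apply: gauge_diam_le => //; exact: rd.
by move=> sj; rewrite nth_default// gauge_diam0.
Unshelve. all: by end_near. Qed.

(** * Differential calculus on a rectangle *)

Lemma within_continuous_epsP (R : realType) (V : normedModType R) (K : set V)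
    (F : V -> R) :
  {within K, continuous F} <-> forall x, K x -> forall e, 0 < e ->
    exists2 r, 0 < r & forall y, K y -> `|x - y| < r -> `|F x - F y| <= e.
Proof.
split=> [/subspace_continuousP cF x Kx e e0|H].
  have /cvgrPdist_le/(_ _ e0) := cF x Kx.
  move=> /nbhs_ballP[r /= r0 H]; exists r => // y Ky xy.
  by apply: H => //; rewrite -ball_normE.
apply/subspace_continuousP => x Kx; apply/cvgrPdist_le => e e0.
have [r r0 Hr] := H x Kx e e0.
apply/nbhs_ballP; exists r => // y; rewrite -ball_normE /= => xy Ky.
exact: Hr.
Qed.

Lemma rectangle_between (R : realType) d (a b x y z : 'rV[R]_d) :
  rectangle a b x -> rectangle a b y ->
  (forall l, (x 0 l <= z 0 l <= y 0 l) || (y 0 l <= z 0 l <= x 0 l)) ->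
  rectangle a b z.
Proof.
move=> Kx Ky H l; have := H l; have := Kx l; have := Ky l.
by move=> /andP[? ?] /andP[? ?] /orP[] /andP[? ?]; apply/andP; split; lra.
Qed.

Lemma norm_between (R : realType) d (x y z w : 'rV[R]_d) (r : R) :
  (forall l, (x 0 l <= z 0 l <= y 0 l) || (y 0 l <= z 0 l <= x 0 l)) ->
  `|x - w| <= r -> `|y - w| <= r -> `|z - w| <= r.
Proof.
move=> H xr yr; have r0 : 0 <= r := le_trans (normr_ge0 _) xr.
apply/(rV_norm_leP _ r0) => l.
have := le_trans (coord_le_norm (x - w) l) xr.
have := le_trans (coord_le_norm (y - w) l) yr.
rewrite !mxE !ler_norml => /andP[? ?] /andP[? ?].
by move: (H l) => /orP[] /andP[? ?]; apply/andP; split; lra.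
Qed.

(** The end points may lie on faces of the rectangle, but at an interior point of the segment all
    small increments stay inside. There [pfilter] is the filter [0^'], and the mean value theorem in
    one variable applies. *)
Lemma partial_mvt_pos (R : realType) d (a b : 'rV[R]_d)
    (F : 'rV[R]_d -> R) (i : 'I_d) (z : 'rV[R]_d) (s : R) :
  {within rectangle a b, continuous F} ->
  (forall x, rectangle a b x -> pderivable (rectangle a b) i F x) ->
  0 < s -> rectangle a b z -> rectangle a b (z + s *: delta_mx 0 i) ->
  exists2 c, 0 <= c <= s & F (z + s *: delta_mx 0 i) - F z =
    partial (rectangle a b) i F (z + c *: delta_mx 0 i) * s.
Proof.
move=> Fc Fd s0 Kz Kzs; set e := delta_mx 0 i.
have Kc c : 0 <= c <= s -> rectangle a b (z + c *: e).
  move=> /andP[c0 cs]; apply: (rectangle_between Kz Kzs) => l; rewrite !mxE /=.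
  case: (l == i) => /=; rewrite ?mulr0 ?mulr1 ?addr0 ?lexx//.
  by apply/orP; left; apply/andP; split; lra.
have e1 : `|e| <= 1.
  apply/rV_norm_leP => // l; rewrite !mxE /=.
  by case: (l == i); rewrite ?normr0 ?normr1.
pose phi h := F (z + h *: e).
pose dphi h := partial (rectangle a b) i F (z + h *: e).
have [||c c0s] := @MVT R phi dphi 0 s s0.
- move=> h; rewrite in_itv/= => /andP[h0 hs].
  have Kh : rectangle a b (z + h *: e) by apply: Kc; rewrite !ltW.
  have pE : (fun k => k^-1 *: ((phi \o shift h) (k *: 1) - phi h))
          = pquot F i (z + h *: e).
    apply/funext => k; rewrite /pquot /phi /=; congr (_ * (F _ - _)).
    by rewrite [k *: (1 : R)]mulr1 scalerDl addrCA addrC.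
  have fE : pfilter (rectangle a b) i (z + h *: e) = 0^'.
    have nK : \forall k \near (0 : R)^', rectangle a b (z + h *: e + k *: e).
      have m0 : 0 < Num.min h (s - h) by rewrite lt_min h0 subr_gt0.
      near=> k; rewrite -addrA -scalerDl; apply: Kc.
      have : `|k| < Num.min h (s - h) by near: k; exact: dnbhs0_lt.
      rewrite lt_min !ltr_norml => /andP[/andP[? ?] /andP[? ?]].
      by apply/andP; split; lra.
    rewrite /pfilter; apply/seteqP; split => A; rewrite /within /= => A0.
      near=> k; have : rectangle a b (z + h *: e + k *: e) by near: k.
      by near: k.
    by near=> k => _; near: k.
  have := Fd _ Kh; rewrite /pderivable fE -pE => dF.
  apply: DeriveDef; first exact: dF.
  by rewrite /derive pE /dphi /partial fE.
- apply/within_continuous_epsP => h; rewrite /= in_itv/= => hs eps eps0.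
  have /within_continuous_epsP/(_ _ (Kc _ hs) _ eps0)[r r0 Hr] := Fc.
  exists r => // k; rewrite in_itv/= => ks hk; apply: Hr; first exact: Kc.
  rewrite [X in `|X|](_ : _ = (h - k) *: e).
    by rewrite normrZ (le_lt_trans _ hk)// ler_piMr.
  by rewrite scalerBl opprD addrACA subrr add0r.
- rewrite subr0 /phi scale0r addr0 => ->; exists c => //.
  by move: c0s; rewrite in_itv/= => /andP[c0 cs]; rewrite !ltW.
Unshelve. all: by end_near. Qed.

Lemma partial_mvt (R : realType) d (a b : 'rV[R]_d)
    (F : 'rV[R]_d -> R) (i : 'I_d) (z : 'rV[R]_d) (s : R) :
  {within rectangle a b, continuous F} ->
  (forall x, rectangle a b x -> pderivable (rectangle a b) i F x) ->
  rectangle a b z -> rectangle a b (z + s *: delta_mx 0 i) ->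
  exists2 c, (0 <= c <= s) || (s <= c <= 0) &
    F (z + s *: delta_mx 0 i) - F z =
    partial (rectangle a b) i F (z + c *: delta_mx 0 i) * s.
Proof.
move=> Fc Fd Kz Kzs; have [s0|s0|s0] := ltgtP s 0.
- have sN : 0 < - s by rewrite oppr_gt0.
  have [|c /andP[c0 cs]] := partial_mvt_pos Fc Fd sN Kzs.
    by rewrite -addrA -scalerDl subrr scale0r addr0.
  rewrite -addrA -scalerDl subrr scale0r addr0 -addrA -scalerDl => E.
  exists (s + c); first by apply/orP; right; apply/andP; split; lra.
  by rewrite -opprB E mulrN opprK.
- have [c c0s E] := partial_mvt_pos Fc Fd s0 Kz Kzs.
  by exists c; rewrite ?c0s.
- by exists 0; rewrite s0 ?lexx// scale0r addr0 subrr mulr0.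
Qed.

(** One goes from y to x by changing one coordinate at a time. The path stays in the box spanned by
    x and y, hence in every max-norm ball containing both; the centre [w] is left free because it is
    needed at y and at a third point. *)
Lemma rectangle_mvt (R : realType) d (a b : 'rV[R]_d) (F : 'rV[R]_d -> R)
    (x y : 'rV[R]_d) :
  C1_on (rectangle a b) F -> rectangle a b x -> rectangle a b y ->
  exists xi : 'I_d -> 'rV[R]_d,
  [/\ forall i, rectangle a b (xi i),
      forall i w r, `|x - w| <= r -> `|y - w| <= r -> `|xi i - w| <= r &
      F x - F y = \sum_i partial (rectangle a b) i F (xi i) * (x 0 i - y 0 i)].
Proof.
move=> [Fc Fd] Kx Ky.
pose p (j : nat) : 'rV[R]_d := \row_l if (l < j)%N then x 0 l else y 0 l.
have pS (i : 'I_d) : p i.+1 = p i + (x 0 i - y 0 i) *: delta_mx 0 i.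
  apply/rowP => l; rewrite !mxE /= ltnS; case: (ltngtP l i) => [li|li|li].
  - by rewrite (_ : (l == i) = false) ?mulr0 ?addr0//; apply/negbTE; rewrite neq_ltn li.
  - by rewrite (_ : (l == i) = false) ?mulr0 ?addr0//; apply/negbTE; rewrite neq_ltn li orbT.
  - by rewrite (ord_inj li) eqxx mulr1 addrC subrK.
have pb j l : (x 0 l <= p j 0 l <= y 0 l) || (y 0 l <= p j 0 l <= x 0 l).
  rewrite mxE; case: ifP => _; rewrite !lexx ?andbT ?andTb/=.
    by case: (leP (x 0 l) (y 0 l)) => //= /ltW.
  by case: (leP (x 0 l) (y 0 l)) => //= /ltW.
have pK j : rectangle a b (p j) by exact: rectangle_between (pb j).
have H (i : 'I_d) : exists c : R, ((0 <= c <= x 0 i - y 0 i) || (x 0 i - y 0 i <= c <= 0)) /\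
    F (p i.+1) - F (p i) =
    partial (rectangle a b) i F (p i + c *: delta_mx 0 i) * (x 0 i - y 0 i).
  have [||c c1 c2] := @partial_mvt R d a b F i (p i) (x 0 i - y 0 i) Fc (Fd i).1.
  - exact: pK.
  - by rewrite -pS; exact: pK.
  by exists c; split=> //; rewrite pS.
have [c Hc] := choice H.
have xb (i : 'I_d) l : (x 0 l <= (p i + c i *: delta_mx 0 i) 0 l <= y 0 l) ||
    (y 0 l <= (p i + c i *: delta_mx 0 i) 0 l <= x 0 l).
  have [ci _] := Hc i; have := pb i l; rewrite !mxE /=.
  case: eqVneq => [->|]; last by rewrite mulr0 addr0.
  rewrite ltnn mulr1 => _.
  by move: ci => /orP[] /andP[? ?]; apply/orP; [right|left]; apply/andP; split; lra.
exists (fun i : 'I_d => p i + c i *: delta_mx 0 i); split=> [i|i w r xr yr|].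
- exact: rectangle_between (xb i).
- exact: norm_between (xb i) xr yr.
- have xE : x = p d by apply/rowP => l; rewrite mxE ltn_ord.
  have yE : y = p 0%N by apply/rowP => l; rewrite mxE.
  rewrite {1}xE {1}yE -(@telescope_sumr _ 0 d (fun j => F (p j)))// big_mkord.
  apply: eq_bigr => i _; by have [_ ->] := Hc i.
Qed.

Lemma rectangle_compact (R : realType) d (a b : 'rV[R]_d) :
  compact (rectangle a b).
Proof.
have := @rV_compact R d (fun i => `[a 0 i, b 0 i]%classic).
rewrite (_ : [set _ | _] = rectangle a b).
  by apply => i; exact: segment_compact.
apply/seteqP; split => x H i; have := H i.
  by rewrite /= in_itv.
by rewrite /= in_itv.
Qed.

Lemma rectangle_bounded (R : realType) d (a b : 'rV[R]_d) (F : 'rV[R]_d -> R) :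
  {within rectangle a b, continuous F} ->
  exists2 C, 0 < C & forall x, rectangle a b x -> `|F x| <= C.
Proof.
move=> Fc; have := continuous_compact Fc (@rectangle_compact R d a b).
move=> /compact_bounded[M [_ HM]]; exists (`|M| + 1) => [|x Kx].
  by rewrite ltr_wpDl.
apply: (HM (`|M| + 1)); last by exists x.
by rewrite (le_lt_trans (ler_norm _))// ltrDl.
Qed.

Lemma finite_upper_bound (R : realType) (I : finType) (P : I -> R -> Prop) :
  (forall i C C', P i C -> C <= C' -> P i C') ->
  (forall i, exists2 C, 0 < C & P i C) ->
  exists2 C, 0 < C & forall i, P i C.
Proof.
move=> mono H; have H' i : exists C, 0 < C /\ P i C.
  by have [C] := H i; exists C.
have [C HC] := choice H'.
(* The summand 1 keeps the constant positive when [I] is empty. *)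
exists (1 + \sum_i C i) => [|i].
  by rewrite ltr_wpDr//; apply: sumr_ge0 => i _; rewrite ltW// (HC i).1.
apply: mono (HC i).2 _; rewrite (bigD1 i)//= addrCA lerDl addr_ge0//.
by apply: sumr_ge0 => j _; rewrite ltW// (HC j).1.
Qed.

Lemma finite_lower_bound (R : realType) (I : finType) (P : I -> R -> Prop) :
  (forall i r r', P i r -> r' <= r -> P i r') ->
  (forall i, exists2 r, 0 < r & P i r) ->
  exists2 r, 0 < r & forall i, P i r.
Proof.
move=> mono H.
have [i C C' [C0 HC] CC'|i|C C0 HC] :=
    @finite_upper_bound R I (fun i C => 0 < C /\ P i C^-1).
- have C'0 : 0 < C' by exact: lt_le_trans CC'.
  by split=> //; apply: mono HC _; rewrite lef_pV2.
- by have [r r0 Hr] := H i; exists r^-1; rewrite ?invrK ?invr_gt0.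
- by exists C^-1 => [|i]; [rewrite invr_gt0|have [] := HC i].
Qed.

Lemma sum_norm_le (R : realType) (I : finType) (a : I -> R) (c : R) :
  (forall i, `|a i| <= c) -> `|\sum_i a i| <= #|I|%:R * c.
Proof.
move=> ac; apply: le_trans (ler_norm_sum _ _ _) _.
apply: le_trans (ler_sum _ (fun i _ => ac i)) _.
by rewrite sumr_const mulr_natl.
Qed.

Lemma C1_lipschitz (R : realType) d (a b : 'rV[R]_d) (F : 'rV[R]_d -> R) :
  C1_on (rectangle a b) F ->
  exists2 C, 0 < C & forall x y, rectangle a b x -> rectangle a b y ->
    `|F x - F y| <= C * `|x - y|.
Proof.
move=> FC.
have [|i|C C0 HC] := @finite_upper_bound R 'I_d (fun i C =>
    forall x, rectangle a b x -> `|partial (rectangle a b) i F x| <= C).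
- by move=> i C C' H CC' x Kx; exact: le_trans (H x Kx) CC'.
- exact: rectangle_bounded (FC.2 i).2.
exists (d.+1%:R * C) => [|x y Kx Ky]; first by rewrite mulr_gt0.
have [xi [Kxi _ ->]] := rectangle_mvt FC Kx Ky.
rewrite -mulrA.
apply: (@le_trans _ _ (#|'I_d|%:R * (C * `|x - y|))).
  apply: sum_norm_le => i; rewrite normrM ler_pM//; first exact: HC.
  by have := coord_le_norm (x - y) i; rewrite !mxE.
by rewrite card_ord ler_wpM2r ?ler_nat// mulr_ge0// ltW.
Qed.

(** The mean value formula leaves the increments of the first partials between y and [xi i], and the
    partials are Lipschitz because they are C^1. *)
Lemma C2_taylor (R : realType) d (a b : 'rV[R]_d) (F : 'rV[R]_d -> R) :
  C2_on (rectangle a b) F ->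
  exists2 C, 0 < C & forall x y, rectangle a b x -> rectangle a b y ->
    `|F x - F y - \sum_i partial (rectangle a b) i F y * (x 0 i - y 0 i)|
      <= C * `|x - y| ^+ 2.
Proof.
move=> [FC FC2].
have [|i|C C0 HC] := @finite_upper_bound R 'I_d (fun i C =>
    forall x y, rectangle a b x -> rectangle a b y ->
    `|partial (rectangle a b) i F x - partial (rectangle a b) i F y|
      <= C * `|x - y|).
- move=> i C C' H CC' x y Kx Ky; apply: le_trans (H x y Kx Ky) _.
  by rewrite ler_wpM2r.
- exact: C1_lipschitz.
exists (d.+1%:R * C) => [|x y Kx Ky]; first by rewrite mulr_gt0.
have [xi [Kxi xib ->]] := rectangle_mvt FC Kx Ky.
rewrite -sumrB -mulrA.
apply: (@le_trans _ _ (#|'I_d|%:R * (C * `|x - y| ^+ 2))).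
  apply: sum_norm_le => i; rewrite -mulrBl normrM expr2 mulrA ler_pM//.
    apply: le_trans (HC i _ _ (Kxi i) Ky) _; rewrite ler_wpM2l ?(ltW C0)//.
    by apply: xib => //; rewrite subrr normr0.
  by have := coord_le_norm (x - y) i; rewrite !mxE.
by rewrite card_ord ler_wpM2r ?ler_nat// mulr_ge0 ?exprn_ge0// ltW.
Qed.

(** Strict differentiability: both points move while the derivative stays frozen at x0. This is what
    an injectivity estimate near x0 requires. *)
Lemma C1_strict_diff (R : realType) d (a b : 'rV[R]_d) (F : 'rV[R]_d -> R)
    (x0 : 'rV[R]_d) (e : R) :
  C1_on (rectangle a b) F -> rectangle a b x0 -> 0 < e ->
  exists2 r, 0 < r & forall x y, rectangle a b x -> rectangle a b y ->
    `|x - x0| <= r -> `|y - x0| <= r ->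
    `|F x - F y - \sum_i partial (rectangle a b) i F x0 * (x 0 i - y 0 i)|
      <= e * `|x - y|.
Proof.
move=> FC Kx0 e0.
have e'0 : 0 < e / d.+1%:R by rewrite divr_gt0.
have [||r r0 Hr] := @finite_lower_bound R 'I_d (fun i r =>
    forall x, rectangle a b x -> `|x - x0| <= r ->
    `|partial (rectangle a b) i F x - partial (rectangle a b) i F x0|
      <= e / d.+1%:R).
- by move=> i r r' H rr' x Kx xr; apply: H => //; exact: le_trans rr'.
- move=> i.
  have /within_continuous_epsP/(_ _ Kx0 _ e'0)[r r0 Hr] := (FC.2 i).2.
  exists (r / 2) => [|x Kx xr]; first by rewrite divr_gt0.
  rewrite distrC Hr// distrC (le_lt_trans xr)// ltr_pdivrMr//.
  by rewrite mulr_natr mulr2n ltrDl.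
exists r => // x y Kx Ky xr yr.
have [xi [Kxi xib ->]] := rectangle_mvt FC Kx Ky.
rewrite -sumrB.
apply: (@le_trans _ _ (#|'I_d|%:R * (e / d.+1%:R * `|x - y|))).
  apply: sum_norm_le => i; rewrite -mulrBl normrM ler_pM//.
    by apply: Hr => //; exact: xib.
  by have := coord_le_norm (x - y) i; rewrite !mxE.
rewrite card_ord mulrA ler_wpM2r// mulrCA ger_pMr//.
by rewrite ler_pdivrMr ?ltr0n// mul1r ler_nat.
Qed.

(** * Expansion of the gradient maps *)

(** Rows come before columns: k rows of a maximal free family form a matrix of rank k, among whose
    columns k independent ones are then selected. *)
Lemma rank_minor (F : fieldType) (p n k : nat) (A : 'M[F]_(p, n)) :
  (k <= \rank A)%N ->
  exists (J : 'I_k -> 'I_p) (I : 'I_k -> 'I_n),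
    injective J /\ mxsub J I A \in unitmx.
Proof.
move=> kA; pose J i := maxrankfun A (widen_ord kA i).
have Jinj : injective J.
  by move=> i i' /maxrankfun_inj/(congr1 val)/= /val_inj.
have Jfree : row_free (rowsub J A).
  have /row_freeP[B AB] := maxrowsub_free A.
  (* A right inverse for all selected rows; only its columns belonging to the k retained rows are
     kept. *)
  apply/row_freeP; exists (B *m (rowsub (widen_ord kA) 1%:M)^T).
  have -> : rowsub J A = rowsub (widen_ord kA) (rowsub (maxrankfun A) A).
    by apply/matrixP => i j; rewrite !mxE.
  rewrite mulmxA mul_rowsub_mx AB; apply/matrixP => i j; rewrite !mxE.
  rewrite (bigD1 (widen_ord kA j))//= !mxE eqxx mulr1 big1 ?addr0.
    by rewrite -(val_eqE (widen_ord kA i)) -(val_eqE i).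
  by move=> l lj; rewrite !mxE [widen_ord kA j == l]eq_sym (negbTE lj) mulr0.
have full : row_full (rowsub J A)^T by rewrite /row_full mxrank_tr.
exists J, (fullrankfun full); split=> //.
rewrite -unitmx_tr (_ : _^T = rowsub (fullrankfun full) (rowsub J A)^T).
  exact: fullrowsub_unit.
by apply/matrixP => i j; rewrite !mxE.
Qed.

Lemma ler_sum_term (R : numDomainType) (I : finType) (F : I -> R) (i : I) :
  (forall j, 0 <= F j) -> F i <= \sum_j F j.
Proof. by move=> F0; rewrite (bigD1 i)//= lerDl sumr_ge0. Qed.

Section Bilipschitz.
Context {R : realType} {d m k : nat} (a b : 'rV[R]_d) (f : 'rV[R]_d -> 'rV[R]_m).
Let K := rectangle a b.

Definition grad_dot (t : 'rV[R]_m) (i : 'I_d) (x : 'rV[R]_d) : R :=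
  dot t (\row_l partial K i (fun y => f y 0 l) x).

(* [I] and [J] select a nonvanishing k x k minor of the Hessian of t.f: the map
   x |-> (d_i (t.f))_(i in I) expands in the coordinates in [J]. *)
Definition expands_at (x0 : 'rV[R]_d) (t : 'rV[R]_m) (L : R) (r : R) : Prop :=
  exists I J : 'I_k -> 'I_d, injective J /\
  forall x y, K x -> K y -> `|x - x0| <= r -> `|y - x0| <= r ->
  forall Y Z : R, 0 <= Y -> 0 <= Z ->
    (forall i, `|grad_dot t (I i) x - grad_dot t (I i) y| <= `|t| * Y) ->
    (forall l, (forall i, J i != l) -> `|x 0 l - y 0 l| <= Z) ->
    `|x - y| <= L * (Y + Z).

(** The quantitative inverse function argument for a minor that is invertible at (x0, t0), stable
    under small changes of t. One parameter r serves as radius and as inverse of the constant, so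
    that the property holds for all small r at once, as compactness will require. *)
Lemma expands_near (x0 : 'rV[R]_d) (t0 : 'rV[R]_m) :
  C2_map K f -> K x0 -> `|t0| = 1 ->
  (k <= \rank (\matrix_(i, j) dot t0 (second_deriv K f x0 i j)))%N ->
  exists2 eta, 0 < eta & forall t r, `|t0 - t| < eta -> `|t| = 1 ->
    0 < r -> r < eta -> expands_at x0 t r^-1 r.
Proof.
move=> fC Kx0 t01 rk; have [J [I [Jinj unitB]]] := rank_minor rk.
set H := (\matrix_(i, j) _) in rk unitB.
set Bm := invmx (mxsub J I H).
pose beta := 1 + \sum_i \sum_j `|Bm i j|.
pose S := \sum_l \sum_p \sum_i `|second_deriv K f x0 p i 0 l|.
pose S' := \sum_p \sum_i `|H p i|.
have beta_ge i j : `|Bm i j| <= beta.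
  rewrite (le_trans (ler_sum_term j (fun j => normr_ge0 (Bm i j))))//.
  rewrite (le_trans (@ler_sum_term _ _ (fun i => \sum_j `|Bm i j|) i _))//.
    by move=> *; rewrite sumr_ge0.
  by rewrite lerDr.
have S'_ge i j : `|H i j| <= S'.
  rewrite (le_trans (ler_sum_term j (fun j => normr_ge0 (H i j))))//.
  apply: (@ler_sum_term _ _ (fun i => \sum_j `|H i j|)) => *.
  by rewrite sumr_ge0.
have S_ge l p i : `|second_deriv K f x0 p i 0 l| <= S.
  rewrite (le_trans (ler_sum_term i
    (fun i => normr_ge0 (second_deriv K f x0 p i 0 l))))//.
  rewrite (le_trans (@ler_sum_term _ _
    (fun p => \sum_i `|second_deriv K f x0 p i 0 l|) p _))//.
    by move=> *; rewrite sumr_ge0.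
  apply: (@ler_sum_term _ _ (fun l => \sum_p \sum_i
    `|second_deriv K f x0 p i 0 l|)) => *.
  by rewrite sumr_ge0// => *; rewrite sumr_ge0.
have beta0 : 0 < beta.
  by rewrite ltr_wpDr// !sumr_ge0// => *; rewrite sumr_ge0.
have S0 : 0 <= S by rewrite sumr_ge0// => *; rewrite sumr_ge0// => *; rewrite sumr_ge0.
have S'0 : 0 <= S' by rewrite sumr_ge0// => *; rewrite sumr_ge0.
(* [e1] and [eta1] are chosen so that replacing the increments of [grad_dot t]
   by [H] costs at most |x - y| / (2 c), which is absorbed on the left. *)
pose c := k.+1%:R * beta.
have c0 : 0 < c by rewrite mulr_gt0.
pose e1 := (4 * c * m.+1%:R)^-1.
have e10 : 0 < e1 by rewrite invr_gt0 !mulr_gt0.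
have [||r1 r10 Hr1] := @finite_lower_bound R ('I_m * 'I_d)%type (fun li r =>
  forall x y, K x -> K y -> `|x - x0| <= r -> `|y - x0| <= r ->
  `|partial K li.2 (fun y => f y 0 li.1) x - partial K li.2 (fun y => f y 0 li.1) y -
    \sum_p second_deriv K f x0 p li.2 0 li.1 * (x 0 p - y 0 p)| <= e1 * `|x - y|).
- move=> li r r' Hr rr' x y Kx Ky xr yr.
  by apply: Hr => //; [apply: le_trans xr _|apply: le_trans yr _].
- move=> [l i] /=; have [_ /(_ i) C1] := fC l.
  have [r r0 Hr] := C1_strict_diff C1 Kx0 e10.
  exists r => // x y Kx Ky xr yr; have := Hr x y Kx Ky xr yr.
  by congr (`|_ - _| <= _); apply: eq_bigr => p _; rewrite !mxE.
pose eta1 := e1 / (d.+1%:R * (S + 1)).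
have eta10 : 0 < eta1 by rewrite divr_gt0// mulr_gt0// ltr_wpDl.
(* Absorbing N / 2 in [N2] leaves N <= 2 * (Z + c * (Y + d.+1%:R * S' * Z)), which [Lam * (Y + Z)]
   dominates. *)
pose Lam := 2 * (1 + c * (1 + d.+1%:R * S')).
have Lam0 : 0 < Lam by rewrite !mulr_gt0// ltr_wpDr// mulr_ge0 ?addr_ge0 ?mulr_ge0// ltW.
exists (Num.min eta1 (Num.min r1 Lam^-1)).
  by rewrite !lt_min eta10 r10 invr_gt0.
move=> t r; rewrite !lt_min => /and3P[tt1 _ _] t1 r0 /and3P[_ rr1 rL].
exists I, J; split; first exact: Jinj.
move=> x y Kx Ky xr yr Y Z Y0 Z0 HY HZ.
set N := `|x - y|.
have N0 : 0 <= N by exact: normr_ge0.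
have dSZ0 : 0 <= d.+1%:R * S' * Z by rewrite !mulr_ge0.
have cN0 : 0 <= (2 * c)^-1 * N.
  by rewrite mulr_ge0// invr_ge0 mulr_ge0// ltW.
have cY0 : 0 <= c * (Y + d.+1%:R * S' * Z) by rewrite mulr_ge0 ?addr_ge0 ?(ltW c0).
have NN0 : 0 <= N / 2 by rewrite divr_ge0.
have xN p : `|x 0 p - y 0 p| <= N.
  by have := coord_le_norm (x - y) p; rewrite !mxE.
have err j : `|grad_dot t j x - grad_dot t j y - \sum_p (x 0 p - y 0 p) * H p j|
    <= (2 * c)^-1 * N.
  (* The error splits into t applied to the remainder of the strict differential at x0, and t - t0
     applied to its linear part. *)
  have -> : grad_dot t j x - grad_dot t j y - \sum_p (x 0 p - y 0 p) * H p j
    = \sum_l (t 0 l * (partial K j (fun y => f y 0 l) x - partial K j (fun y => f y 0 l) y -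
        \sum_p second_deriv K f x0 p j 0 l * (x 0 p - y 0 p)) +
       (t 0 l - t0 0 l) * \sum_p second_deriv K f x0 p j 0 l * (x 0 p - y 0 p)).
    have -> : \sum_p (x 0 p - y 0 p) * H p j =
        \sum_l t0 0 l * \sum_p second_deriv K f x0 p j 0 l * (x 0 p - y 0 p).
      under eq_bigr => p _ do rewrite mxE /dot mulr_sumr.
      rewrite exchange_big /=; apply: eq_bigr => l _; rewrite mulr_sumr.
      by apply: eq_bigr => p _; ring.
    rewrite /grad_dot /dot -!sumrB; apply: eq_bigr => l _; rewrite !mxE.
    ring.
  apply: (@le_trans _ _ (#|'I_m|%:R * (e1 * N + e1 * N))).
    apply: sum_norm_le => l; apply: le_trans (ler_normD _ _) _.
    apply: lerD; rewrite normrM.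
      rewrite -[leRHS]mul1r ler_pM//; first by rewrite -t1 coord_le_norm.
      by apply: (Hr1 (l, j)) => //=; rewrite ?(le_trans xr) ?(le_trans yr)// ltW.
    apply: (@le_trans _ _ (eta1 * (#|'I_d|%:R * (S * N)))).
      rewrite ler_pM//.
        have := coord_le_norm (t0 - t) l; rewrite !mxE distrC => /le_trans; apply.
        exact: ltW.
      by apply: sum_norm_le => p; rewrite normrM ler_pM.
    rewrite card_ord [d%:R * _]mulrA mulrA ler_wpM2r// /eta1 mulrAC.
    rewrite ler_pdivrMr ?mulr_gt0 ?ltr_wpDl// ler_wpM2l ?(ltW e10)//.
    by rewrite ler_pM// ?ler_nat// lerDl.
  rewrite card_ord -mulrDl mulrA ler_wpM2r//.
  apply: (@le_trans _ _ (m.+1%:R * (e1 + e1))).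
    by rewrite ler_wpM2r ?ler_nat// addr_ge0// ltW.
  rewrite /e1 le_eqVlt; apply/orP; left; apply/eqP; field.
  by rewrite lt0r_neq0//= pnatr_eq0.
have wJ i : `|x 0 (J i) - y 0 (J i)| <= c * (Y + d.+1%:R * S' * Z) + N / 2.
  (* [u] is the increment in the coordinates of [J] multiplied by the minor; multiplying by [Bm]
     recovers these coordinates. *)
  pose u j := \sum_p (x 0 p - y 0 p) * H p (I j) -
     \sum_(p | p \notin codom J) (x 0 p - y 0 p) * H p (I j).
  have uE j : u j = \sum_i' (x 0 (J i') - y 0 (J i')) * H (J i') (I j).
    rewrite /u (bigID (mem (codom J)))/= addrK.
    rewrite (eq_bigl (mem [set J i' | i' : 'I_k])); last first.
      move=> p; apply/codomP/imsetP => [[i' ->]|[i' _ ->]]; last by exists i'.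
      by exists i'.
    rewrite big_imset /=; last by move=> ? ? _ _; exact: Jinj.
    by apply: eq_bigl => i'; rewrite inE.
  have -> : x 0 (J i) - y 0 (J i) = \sum_j u j * Bm j i.
    have := congr1 (fun M : 'rV[R]_k => M 0 i)
      (mulmxK unitB (\row_i (x 0 (J i) - y 0 (J i)))).
    rewrite [RHS]mxE => <-; rewrite mxE; apply: eq_bigr => j _; congr (_ * _).
    by rewrite uE mxE; apply: eq_bigr => i' _; rewrite !mxE.
  apply: (@le_trans _ _ (#|'I_k|%:R * ((Y + (2 * c)^-1 * N + d.+1%:R * S' * Z) * beta))).
    apply: sum_norm_le => j; rewrite normrM ler_pM//.
    rewrite /u; set g := grad_dot t (I j) x - grad_dot t (I j) y.
    rewrite (_ : _ - _ = g - (g - \sum_p (x 0 p - y 0 p) * H p (I j)) -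
      \sum_(p | p \notin codom J) (x 0 p - y 0 p) * H p (I j)); last by ring.
    apply: le_trans (ler_normB _ _) _; apply: lerD.
      apply: le_trans (ler_normB _ _) _; apply: lerD; last exact: err.
      by have := HY j; rewrite t1 mul1r.
    rewrite big_mkcond /=.
    apply: (@le_trans _ _ (#|'I_d|%:R * (S' * Z))).
      apply: sum_norm_le => p; case: ifPn => [pJ|_]; last by rewrite normr0 mulr_ge0.
      rewrite normrM mulrC ler_pM// HZ// => i'; apply/eqP => Jp.
      by move/codomP: pJ; apply; exists i'.
    by rewrite card_ord mulrA ler_wpM2r// ler_wpM2r// ler_nat.
  rewrite card_ord mulrCA.
  apply: (@le_trans _ _ ((Y + (2 * c)^-1 * N + d.+1%:R * S' * Z) * c)).
    rewrite /c ler_wpM2l ?ler_wpM2r ?ler_nat ?(ltW beta0)//.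
    by rewrite addr_ge0 ?addr_ge0.
  rewrite le_eqVlt; apply/orP; left; apply/eqP; field.
  by rewrite lt0r_neq0.
have N2 : N <= Z + (c * (Y + d.+1%:R * S' * Z) + N / 2).
  apply/rV_norm_leP => [|p]; first by rewrite !addr_ge0.
  rewrite !mxE; have [/codomP[i ->]|pJ] := boolP (p \in codom J).
    by apply: le_trans (wJ i) _; rewrite lerDr.
  apply: (@le_trans _ _ Z); last by rewrite lerDl addr_ge0.
  apply: HZ => i; apply/eqP => Jp; move/codomP: pJ; apply; exists i; exact: esym.
apply: (@le_trans _ _ (Lam * (Y + Z))); last first.
  by rewrite ler_wpM2r ?addr_ge0// -[leLHS]invrK lef_pV2 ?posrE ?invr_gt0 ?ltW.
apply: (@le_trans _ _ (2 * (Z + c * (Y + d.+1%:R * S' * Z)))); first by lra.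
rewrite -subr_ge0 /Lam.
rewrite (_ : _ - _ = 2 * (Y + c * Z + c * (d.+1%:R * S') * Y)); last by ring.
by rewrite !mulr_ge0 ?addr_ge0 ?mulr_ge0// ltW.
Qed.

(** Compactness of the unit sphere makes r independent of t. Other t reduce to it by scaling, since
    the hypothesis with [|t| * Y] is homogeneous in t. *)
Lemma expands_locally (x0 : 'rV[R]_d) : C2_map K f -> K x0 ->
  (forall t : 'rV[R]_m, t != 0 ->
    (k <= \rank (\matrix_(i, j) dot t (second_deriv K f x0 i j)))%N) ->
  exists2 r, 0 < r & forall t, t != 0 -> expands_at x0 t r^-1 r.
Proof.
move=> fC Kx0 rk; pose S : set 'rV[R]_m := [set t | `|t| = 1].
have Sc : compact S.
  apply: bounded_closed_compact.
    by exists 1; split=> // M M1 t /= ->; exact: ltW.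
  apply: (@closed_comp _ _ (fun t : 'rV[R]_m => `|t|) [set y | y = 1]).
    by move=> t _; exact: norm_continuous.
  exact: closed_eq.
(* Compactness in near-covering form: a property valid for t near each t0 and all small r holds for
   all t in [S] once r is small. *)
have near_exp : \forall r \near (0 : R)^'+,
    S `<=` (fun t => `|t| = 1 -> expands_at x0 t r^-1 r).
  apply: (compact_near_coveringP S).1 => //= t0 t01.
  have t0N : t0 != 0 by rewrite -normr_eq0 t01 oner_eq0.
  have [eta eta0 H] := expands_near fC Kx0 t01 (rk _ t0N).
  exists ([set t | `|t0 - t| < eta], [set r | 0 < r /\ r < eta]) => /=.
    split; first by apply/nbhs_ballP; exists eta => // t; rewrite -ball_normE.
    near=> r; split; near: r; first exact: nbhs_right_gt.
    exact: nbhs_right_lt.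
  by move=> [t r] /= [tt [r0 reta]] t1; exact: H.
near (0 : R)^'+ => r.
have r0 : 0 < r by near: r; exact: nbhs_right_gt.
have Hr : S `<=` (fun t => `|t| = 1 -> expands_at x0 t r^-1 r) by near: r.
exists r => // t tN; have t0 : 0 < `|t| by rewrite normr_gt0.
have s1 : `| `|t|^-1 *: t| = 1.
  by rewrite normrZ gtr0_norm ?invr_gt0// mulVf// gt_eqF.
have [I [J [Jinj E]]] := Hr _ s1 s1.
exists I, J; split=> // x y Kx Ky xr yr Y Z Y0 Z0 HY HZ.
apply: E => // i; rewrite s1 mul1r.
have sE z : grad_dot (`|t|^-1 *: t) (I i) z = `|t|^-1 * grad_dot t (I i) z.
  by rewrite /grad_dot /dot mulr_sumr; apply: eq_bigr => l _; rewrite !mxE mulrA.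
rewrite !sE -mulrBr normrM gtr0_norm ?invr_gt0// ler_pdivrMl//.
Unshelve. all: by end_near. Qed.
End Bilipschitz.

(** * Exponential sums *)

(** The squared modulus of the sum of the e^(i theta), in real form. *)
Definition expsum_sq (R : realType) (I : finType) (theta : I -> R) : R :=
  (\sum_i cos (theta i)) ^+ 2 + (\sum_i sin (theta i)) ^+ 2.

Lemma expsum_sq_ge0 (R : realType) (I : finType) (theta : I -> R) :
  0 <= expsum_sq theta.
Proof. by rewrite addr_ge0 ?sqr_ge0. Qed.

Lemma expsum_sqE (R : realType) (I : finType) (theta : I -> R) :
  expsum_sq theta = \sum_i \sum_j cos (theta i - theta j).
Proof.
rewrite /expsum_sq !expr2 !big_distrlr /= -big_split /=.
by apply: eq_bigr => i _; rewrite -big_split; apply: eq_bigr => j _; rewrite cosB.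
Qed.

Lemma expsum_sq_le (R : realType) (I : finType) (theta : I -> R) :
  expsum_sq theta <= #|I|%:R ^+ 2.
Proof.
rewrite expsum_sqE.
apply: (@le_trans _ _ (\sum_(i : I) \sum_(j : I) 1)).
  by apply: ler_sum => i _; apply: ler_sum => j _; exact: cos_le1.
by rewrite !sumr_const -mulrnA -[leLHS]mulr_natl mulr1 natrM expr2.
Qed.

(** An exponential sum over a box factors into sums over its sides. This is seen in [R[i]], where x
    |-> e^(ix) and the squared modulus are multiplicative. *)
Lemma expsum_sq_prod (R : realType) (d Q : nat) (theta : 'I_d -> 'I_Q -> R) :
  expsum_sq (fun v : {ffun 'I_d -> 'I_Q} => \sum_i theta i (v i)) =
  \prod_i expsum_sq (theta i).
Proof.
pose e (x : R) : R[i] := Complex (cos x) (sin x).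
have eD x y : e (x + y) = e x * e y.
  by rewrite /e cosD sinD; congr Complex; rewrite addrC.
have e0 : e 0 = 1 by rewrite /e cos0 sin0.
pose N (z : R[i]) := complex.Re z ^+ 2 + complex.Im z ^+ 2.
have NM : {morph N : x y / x * y} by move=> [a b] [c d'] /=; rewrite /N /=; ring.
have N1 : N 1 = 1 by rewrite /N /= expr1n expr0n addr0.
have Ne I (t : I -> R) (s : seq I) : (\sum_(i <- s) cos (t i)) ^+ 2 +
    (\sum_(i <- s) sin (t i)) ^+ 2 = N (\sum_(i <- s) e (t i)).
  suff -> : \sum_(i <- s) e (t i) =
      Complex (\sum_(i <- s) cos (t i)) (\sum_(i <- s) sin (t i)) by [].
  by elim/big_rec3 : _ => // i x y z _ ->.
rewrite /expsum_sq Ne.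
under [RHS]eq_bigr do rewrite Ne.
rewrite -(big_morph N NM N1) bigA_distr_bigA /=; congr N.
by apply: eq_bigr => v _; rewrite (big_morph e eD e0).
Qed.

(** Equal to (sin(pi Q x) / sin(pi x))^2 off the integers, that is Q times the usual Fejer
    kernel. *)
Definition fejer (R : realType) (Q : nat) (x : R) : R :=
  expsum_sq (fun v : 'I_Q => pi *+ 2 * (v%:R * x)).

Lemma fejer_ge0 (R : realType) Q (x : R) : 0 <= fejer Q x.
Proof. exact: expsum_sq_ge0. Qed.

Lemma fejer_le (R : realType) Q (x : R) : fejer Q x <= Q%:R ^+ 2.
Proof. by rewrite -[in leRHS](card_ord Q) expsum_sq_le. Qed.

Lemma cos_period (R : realType) (x : R) (n : int) :
  cos (x + pi *+ 2 * n%:~R) = cos x.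
Proof.
case: n => n; first by rewrite mulr_natr periodicn//; exact: cosD2pi.
rewrite NegzE mulrNz mulrN mulr_natr.
have := periodicn (@cosD2pi R) n.+1 (x - pi *+ 2 *+ n.+1).
by rewrite subrK.
Qed.

Lemma sin_period (R : realType) (x : R) (n : int) :
  sin (x + pi *+ 2 * n%:~R) = sin x.
Proof. by rewrite -!cosBpihalf addrAC cos_period. Qed.

Lemma fejer_period (R : realType) Q (x : R) (n : int) :
  fejer Q (x + n%:~R) = fejer Q x.
Proof.
have E (v : 'I_Q) : pi *+ 2 * (v%:R * (x + n%:~R)) =
    pi *+ 2 * (v%:R * x) + pi *+ 2 * (v%:Z * n)%:~R.
  by rewrite intrM -[(Posz v)%:~R]/(v%:R); ring.
by rewrite /fejer /expsum_sq; congr (_ ^+ 2 + _ ^+ 2); apply: eq_bigr => v _;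
  rewrite E ?cos_period ?sin_period.
Qed.

Lemma fejer_opp (R : realType) Q (x : R) : fejer Q (- x) = fejer Q x.
Proof.
rewrite /fejer /expsum_sq; congr (_ ^+ 2 + _).
  by apply: eq_bigr => v _; rewrite !mulrN cosN.
rewrite -[RHS]sqrrN -sumrN; congr (_ ^+ 2).
by apply: eq_bigr => v _; rewrite !mulrN sinN.
Qed.

(** With e(x) = e^(2 pi i x), the geometric sum satisfies (e(x) - 1) * sum = e(Qx) - 1, and |e(Qx) -
    1|^2 <= 4. [E1] and [E2] are the real and imaginary parts of this identity. *)
Lemma fejer_telescope (R : realType) Q (x : R) :
  fejer Q x * (2 - 2 * cos (pi *+ 2 * x)) <= 4.
Proof.
set t := pi *+ 2 * x.
have tE (v : nat) : pi *+ 2 * (v%:R * x) = t *+ v.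
  by rewrite mulrCA mulr_natl.
pose C n := \sum_(v < n) cos (t *+ v); pose S n := \sum_(v < n) sin (t *+ v).
have -> : fejer Q x = C Q ^+ 2 + S Q ^+ 2.
  by rewrite /fejer /expsum_sq; congr (_ ^+ 2 + _ ^+ 2); apply: eq_bigr => v _;
    rewrite tE.
have CS n : C n.+1 = C n + cos (t *+ n) by rewrite /C big_ord_recr.
have SS n : S n.+1 = S n + sin (t *+ n) by rewrite /S big_ord_recr.
have E1 n : cos t * C n - sin t * S n = C n + cos (t *+ n) - 1.
  elim: n => [|n IH]; first by rewrite /C /S !big_ord0 mulr0n cos0; ring.
  by rewrite CS SS [t *+ n.+1]mulrS cosD; lra.
have E2 n : cos t * S n + sin t * C n = S n + sin (t *+ n).
  elim: n => [|n IH]; first by rewrite /C /S !big_ord0 mulr0n sin0; ring.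
  by rewrite CS SS [t *+ n.+1]mulrS sinD; lra.
move: {E1 E2} (E1 Q) (E2 Q) => E1 E2; move: (C Q) (S Q) E1 E2 => {CS SS}{}C {}S E1 E2.
have -> : (C ^+ 2 + S ^+ 2) * (2 - 2 * cos t) = 2 - 2 * cos (t *+ Q).
  have c1 := cos2Dsin2 t; have c2 := cos2Dsin2 (t *+ Q).
  have -> : 2 - 2 * cos t = (cos t - 1) ^+ 2 + sin t ^+ 2 by rewrite -[2]/(1+1) -{1}c1; ring.
  have -> : 2 - 2 * cos (t *+ Q) = (cos (t *+ Q) - 1) ^+ 2 + sin (t *+ Q) ^+ 2.
    by rewrite -[2]/(1+1) -{1}c2; ring.
  have -> : cos (t *+ Q) - 1 = cos t * C - sin t * S - C by rewrite E1; ring.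
  have -> : sin (t *+ Q) = cos t * S + sin t * C - S by rewrite E2; ring.
  by ring.
by have := cos_geN1 (t *+ Q); lra.
Qed.

Lemma cos_pi4_ge (R : realType) (x : R) : 0 <= x <= pi / 4 -> 1 / 2 <= cos x.
Proof.
move=> /andP[x0 x4]; have p2 := pi_ge2 R.
have h : cos (pi / 4) <= cos x.
  by rewrite leNgt ltr_cos ?in_itv/= -?leNgt//; apply/andP; split; lra.
apply: le_trans h.
have c0 : 0 <= cos (pi / 4 : R).
  by apply: cos_ge0_pihalf; apply/andP; split; lra.
have : cos (pi / 4 + pi / 4 : R) = 0.
  by rewrite (_ : _ + _ = pi / 2) ?cos_pihalf//; lra.
rewrite cosD -!expr2; have := cos2Dsin2 (pi / 4 : R).
nra.
Qed.

(** For z = pi y / 2 <= pi / 4 the cosine is at least 1/2, so sin z >= z / 2 by the mean value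
    theorem and sin(2z) >= sin z >= y / 2. The right-hand side is 4 sin(2z)^2. *)
Lemma one_sub_cos_ge (R : realType) (y : R) : 0 <= y <= 1 / 2 ->
  y ^+ 2 <= 2 - 2 * cos (pi *+ 2 * y).
Proof.
move=> /andP[y0 y2]; have p2 := pi_ge2 R.
set z := pi / 2 * y.
have z0 : 0 <= z by rewrite mulr_ge0//; lra.
have z4 : z <= pi / 4 by rewrite /z; nra.
have yz : y <= z by rewrite /z; nra.
have cz : 1 / 2 <= cos z by apply: cos_pi4_ge; rewrite z0.
have sz : z / 2 <= sin z.
  have [|c] := @MVT_segment R sin cos 0 z z0.
    by apply: continuous_subspaceT => x; exact: continuous_sin.
  rewrite in_itv/= sin0 !subr0 => /andP[c0 cz'] ->.
  have : 1 / 2 <= cos c by apply: cos_pi4_ge; rewrite c0 (le_trans cz').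
  by nra.
have s2 : y / 2 <= sin (z + z) by rewrite sinD; nra.
have -> : pi *+ 2 * y = (z + z) + (z + z) by rewrite /z mulr2n; lra.
rewrite cosD; have := cos2Dsin2 (z + z); nra.
Qed.

Lemma fejer_decay (R : realType) Q (y : R) : 0 < y <= 1 / 2 ->
  fejer Q y <= 4 / y ^+ 2.
Proof.
move=> /andP[y0 y2]; rewrite ler_pdivlMr ?exprn_gt0//.
apply: le_trans (fejer_telescope Q y); rewrite ler_wpM2l ?fejer_ge0//.
by apply: one_sub_cos_ge; rewrite ltW.
Qed.

(* Bounds [fejer Q] on the translates of [b / Q, (b + 1) / Q) by integers; its sum
   over b < Q is O(Q^2), the order of the single value [fejer Q 0]. *)
Definition fejer_bound (R : realType) (Q b : nat) : R :=
  16 * Q%:R ^+ 2 * (b.+1%:R ^- 2 + (Q - b)%:R ^- 2).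

Lemma fejer_bound_ge0 (R : realType) Q b : 0 <= fejer_bound R Q b.
Proof.
by rewrite mulr_ge0 ?addr_ge0 ?invr_ge0 ?exprn_ge0// mulr_ge0// exprn_ge0.
Qed.

(** Modulo 1, x lies in [0, 1). In the right half one passes to 1 - x, whose window is counted from
    the other end; this gives the term with Q - b. *)
Lemma fejer_le_bound (R : realType) Q (b : nat) (x : R) : (b < Q)%N ->
  b%:R <= Q%:R * (x - (Num.floor x)%:~R) < b.+1%:R ->
  fejer Q x <= fejer_bound R Q b.
Proof.
move=> bQ; rewrite -(fejer_period Q x (- Num.floor x)) mulrNz.
have : 0 <= x - (Num.floor x)%:~R < 1.
  have /andP[f1 f2] := floor_itv x; rewrite intrD in f2.
  by apply/andP; split; lra.
move: (x - _) => {}x /andP[x0 x1] /andP[bx xb].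
have Q0 : 0 < Q%:R :> R by rewrite ltr0n; lia.
(* For c = 1 the trivial bound Q^2 suffices. For c >= 2, c - 1 >= c / 2 gives y >= c / (2Q), which
   turns the 4 of [fejer_decay] into 16. *)
have key (y : R) (c : nat) : (0 < c)%N -> 0 <= y <= 1 / 2 ->
    c%:R - 1 <= Q%:R * y -> fejer Q y <= 16 * Q%:R ^+ 2 * c%:R ^- 2.
  move=> c0 /andP[y0 y2] cy.
  have cr : 1 <= c%:R :> R by rewrite ler1n.
  case: (ltnP 1 c) => c1; last first.
    have -> : c = 1%N by lia.
    apply: le_trans (fejer_le _ _) _; rewrite expr1n invr1 mulr1.
    by rewrite ler_peMl ?exprn_ge0//; lra.
  have c2 : 2 <= c%:R :> R by rewrite (ler_nat R 2).
  have yc : c%:R / (2 * Q%:R) <= y.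
    by rewrite ler_pdivrMr ?mulr_gt0//; nra.
  have cq0 : 0 < c%:R / (2 * Q%:R) :> R by rewrite divr_gt0 ?mulr_gt0//; lra.
  have y'0 : 0 < y by exact: lt_le_trans yc.
  apply: le_trans (fejer_decay _ _) _; first by rewrite y'0.
  have -> : 16 * Q%:R ^+ 2 * c%:R ^- 2 = 4 / (c%:R / (2 * Q%:R)) ^+ 2 :> R.
    have cN : c%:R != 0 :> R by rewrite lt0r_neq0//; lra.
    by field; rewrite cN lt0r_neq0.
  rewrite ler_pM2l// lef_pV2 ?posrE ?exprn_gt0//.
  by rewrite ler_sqr ?nnegrE ?(ltW cq0).
have pos (c : nat) : 0 <= 16 * Q%:R ^+ 2 * c%:R ^- 2 :> R.
  by rewrite mulr_ge0 ?invr_ge0 ?exprn_ge0// mulr_ge0// exprn_ge0.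
rewrite /fejer_bound mulrDr.
case: (lerP x (1 / 2)) => x2.
  apply: ler_wpDr; first exact: pos.
  by apply: key => //; rewrite ?x0// -natr1; lra.
apply: ler_wpDl; first exact: pos.
rewrite -(fejer_period Q x (-1)) -fejer_opp; apply: key.
- lia.
- by rewrite mulrN1z; apply/andP; split; lra.
- by move: xb; rewrite mulrN1z natrB ?(ltnW bQ)// -natr1; lra.
Qed.

(** Each of the two sums of inverse squares is at most 2 by comparison with a telescoping sum, and
    16 * (2 + 2) = 64. *)
Lemma sum_fejer_bound (R : realType) Q :
  \sum_(b < Q) fejer_bound R Q b <= 64 * Q%:R ^+ 2.
Proof.
rewrite -mulr_sumr big_split /=.
have inv2 n : \sum_(b < n.+1) b.+1%:R ^- 2 <= 2 - n.+1%:R^-1 :> R.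
  elim: n => [|n IH]; first by rewrite big_ord_recr big_ord0 /= expr1n invr1; lra.
  rewrite big_ord_recr /=; apply: le_trans (lerD IH (lexx _)) _.
  have n0 : 0 < n.+1%:R :> R by rewrite ltr0n.
  rewrite -[n.+2%:R]natr1; set u := n.+1%:R in n0 *.
  have u1 : 0 < u + 1 by rewrite addr_gt0.
  have : (u + 1) ^- 2 <= (u * (u + 1))^-1.
    by rewrite lef_pV2 ?posrE ?exprn_gt0 ?mulr_gt0// expr2 ler_pM2r// lerDl.
  suff -> : (u * (u + 1))^-1 = u^-1 - (u + 1)^-1.
    by move: (_ ^- 2) (u^-1) ((u + 1)^-1) => p r s; lra.
  by field; rewrite !lt0r_neq0.
have le2 : \sum_(b < Q) b.+1%:R ^- 2 <= 2 :> R.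
  case: Q => [|n]; first by rewrite big_ord0.
  by apply: le_trans (inv2 n) _; rewrite gerBl invr_ge0.
have -> : \sum_(b < Q) (Q - b)%:R ^- 2 = \sum_(b < Q) b.+1%:R ^- 2 :> R.
  rewrite (reindex_inj rev_ord_inj) /=; apply: eq_bigr => b _.
  by congr (_%:R ^- 2); have := ltn_ord b; lia.
have : 0 <= Q%:R ^+ 2 :> R by rewrite exprn_ge0.
by nra.
Qed.

(** The double sum is the real part of e^(i phi) times a squared modulus. This is how the
    inhomogeneous shift drops out of the count. *)
Lemma expsum_shift_le (R : realType) (I : finType) (eta : I -> R) (phi : R) :
  \sum_p \sum_p' cos (phi + (eta p - eta p')) <= expsum_sq eta.
Proof.
set C := \sum_i cos (eta i); set S := \sum_i sin (eta i).
have -> : \sum_p \sum_p' cos (phi + (eta p - eta p')) =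
    cos phi * expsum_sq eta.
  under eq_bigr => p _.
    under eq_bigr => p' _ do rewrite addrA cosB.
    rewrite big_split /= -!mulr_sumr -/C -/S.
    over.
  rewrite big_split /= -!mulr_suml.
  have -> : \sum_p cos (phi + eta p) = cos phi * C - sin phi * S.
    by rewrite !mulr_sumr -sumrB; apply: eq_bigr => p _; rewrite cosD.
  have -> : \sum_p sin (phi + eta p) = sin phi * C + cos phi * S.
    by rewrite !mulr_sumr -big_split; apply: eq_bigr => p _; rewrite sinD.
  by rewrite /expsum_sq -/C -/S; ring.
by rewrite ler_piMl ?expsum_sq_ge0// cos_le1.
Qed.

(** Each v in [G] makes the exponential sum over the T^m frequencies at least T^m / 2. Its square
    being nonnegative everywhere, the sum over [G] may be enlarged to all differences of points of
    [0, 2L)^d; expanding the square then separates the pairs (j, j'). *)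
Lemma fourier_count (R : realType) (d m L T : nat) (A : 'I_m -> 'I_d -> R)
    (y : 'I_m -> R) (G : {set {ffun 'I_d -> 'I_L}}) :
  (forall (v : {ffun 'I_d -> 'I_L}) (j : {ffun 'I_m -> 'I_T}), v \in G ->
    1 / 2 <= cos (pi *+ 2 * \sum_l (j l)%:R * (y l + \sum_i A l i * (v i)%:R))) ->
  L%:R ^+ d * #|G|%:R * (T%:R ^+ m / 2) ^+ 2 <=
  \sum_(j : {ffun 'I_m -> 'I_T}) \sum_(j' : {ffun 'I_m -> 'I_T})
    \prod_i fejer (2 * L) (\sum_l ((j l)%:R - (j' l)%:R) * A l i).
Proof.
move=> HG.
pose phase (u : 'I_d -> R) (j : {ffun 'I_m -> 'I_T}) : R :=
  pi *+ 2 * \sum_l (j l)%:R * (y l + \sum_i A l i * u i).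
pose S u := expsum_sq (phase u).
have Sge (v : {ffun 'I_d -> 'I_L}) : v \in G ->
    (T%:R ^+ m / 2) ^+ 2 <= S (fun i => (v i)%:R).
  move=> vG; apply: (@le_trans _ _ ((\sum_j cos (phase (fun i => (v i)%:R) j)) ^+ 2)).
    have h : T%:R ^+ m / 2 <= \sum_j cos (phase (fun i => (v i)%:R) j).
      apply: (@le_trans _ _ (\sum_(j : {ffun 'I_m -> 'I_T}) 1 / 2)).
        rewrite sumr_const card_ffun !card_ord.
        by rewrite -[leRHS]mulr_natr natrX; lra.
      by apply: ler_sum => j _; exact: HG.
    by rewrite ler_sqr ?nnegrE ?(le_trans _ h)// divr_ge0// exprn_ge0.
  by rewrite lerDl sqr_ge0.
pose V := {ffun 'I_d -> 'I_(2 * L)}.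
pose W := {ffun 'I_d -> 'I_L}.
have addlt (a b : 'I_L) : (a + b < 2 * L)%N by have := ltn_ord a; have := ltn_ord b; lia.
have injlt (a : 'I_L) : (a < 2 * L)%N by have := ltn_ord a; lia.
(* Every difference v in [0, L)^d is represented L^d times as (v + w) - w with
   v + w and w in [0, 2L)^d, which makes the sum over v a Fejer sum. *)
pose emb (vw : W * W) : V * V :=
  ([ffun i => Ordinal (addlt (vw.1 i) (vw.2 i))],
   [ffun i => Ordinal (injlt (vw.2 i))]).
have emb_inj : injective emb.
  move=> [v w] [v' w'] [/ffunP E1 /ffunP E2].
  have ww : w = w'.
    by apply/ffunP => i; have := E2 i; rewrite !ffunE => -[] /= /val_inj.
  congr (_, _) => //; apply/ffunP => i; have := E1 i; rewrite !ffunE ww => -[] /=.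
  by move/addIn/val_inj.
pose diff (pp : V * V) (i : 'I_d) : R := (pp.1 i)%:R - (pp.2 i)%:R.
have S0 u : 0 <= S u by exact: expsum_sq_ge0.
apply: (@le_trans _ _ (\sum_(pp : V * V) S (diff pp))).
  apply: (@le_trans _ _ (\sum_(vw in finset.setX G [set: W]) S (diff (emb vw)))).
    apply: (@le_trans _ _ (\sum_(vw in finset.setX G [set: W]) (T%:R ^+ m / 2) ^+ 2)).
      rewrite sumr_const cardsX cardsT card_ffun !card_ord -[leRHS]mulr_natl.
      by rewrite natrM natrX [#|G|%:R * _]mulrC.
    apply: ler_sum => -[v w]; rewrite inE => /andP[/= vG _].
    apply: le_trans (Sge v vG) _; rewrite le_eqVlt; apply/orP; left; apply/eqP.
    congr (S _); apply/funext => i; rewrite /diff /= !ffunE /= natrD; ring.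
  rewrite -(big_imset (fun pp => S (diff pp))) /=; last by move=> ? ? _ _; exact: emb_inj.
  rewrite [leRHS](bigID (mem (emb @: finset.setX G [set: W])))/= lerDl.
  by rewrite sumr_ge0.
have -> : \sum_(pp : V * V) S (diff pp) = \sum_(j : {ffun 'I_m -> 'I_T})
    \sum_(j' : {ffun 'I_m -> 'I_T}) \sum_(p : V) \sum_(p' : V)
    cos (phase (diff (p, p')) j - phase (diff (p, p')) j').
  under eq_bigr do rewrite /S expsum_sqE.
  rewrite exchange_big /=; apply: eq_bigr => j _.
  rewrite exchange_big /=; apply: eq_bigr => j' _.
  by rewrite pair_big /=; apply: eq_bigr => -[].
apply: ler_sum => j _; apply: ler_sum => j' _.
pose x i := \sum_l ((j l)%:R - (j' l)%:R) * A l i.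
pose phi := pi *+ 2 * \sum_l ((j l)%:R - (j' l)%:R) * y l.
pose eta (p : V) := \sum_i pi *+ 2 * ((p i)%:R * x i).
have -> : \prod_i fejer (2 * L) (x i) = expsum_sq eta.
  by rewrite -(expsum_sq_prod (fun i (v : 'I_(2 * L)) => pi *+ 2 * (v%:R * x i))).
apply: le_trans (expsum_shift_le eta phi).
rewrite le_eqVlt; apply/orP; left; apply/eqP.
apply: eq_bigr => p _; apply: eq_bigr => p' _; congr cos.
rewrite /phase /phi /eta -mulrBr -!sumrB.
rewrite [X in _ = _ + X](_ : _ =
    pi *+ 2 * \sum_i ((p i)%:R - (p' i)%:R) * x i); last first.
  by rewrite mulr_sumr; apply: eq_bigr => i _; ring.
rewrite -mulrDr; congr (_ * _).
under eq_bigr => l _ do rewrite -mulrBl mulrDr.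
rewrite big_split /=; congr (_ + _).
under eq_bigr => l _ do rewrite mulr_sumr.
rewrite exchange_big /=; apply: eq_bigr => i _; rewrite /diff /= /x mulr_sumr.
by apply: eq_bigr => l _; ring.
Qed.

(** The z are sorted by the windows of length 1 / Q modulo 1 that contain the x z i. On a class the
    product is at most a product of window bounds, and summing this over all classes factors over
    the coordinates. *)
Lemma fejer_sum_count (R : realType) (B : finType) (G : {set B}) (d Q : nat)
    (x : B -> 'I_d -> R) (N : R) : (0 < Q)%N ->
  (forall b : {ffun 'I_d -> 'I_Q},
    #|[set z in G | [forall i, (b i)%:R <= Q%:R * (x z i - (Num.floor (x z i))%:~R)
        < (b i).+1%:R]]|%:R <= N) ->
  \sum_(z in G) \prod_i fejer Q (x z i) <= (64 * Q%:R ^+ 2) ^+ d * N.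
Proof.
move=> Q0 HN; have QR0 : 0 < Q%:R :> R by rewrite ltr0n.
pose fr z i := Q%:R * (x z i - (Num.floor (x z i))%:~R).
have fr0 z i : 0 <= fr z i < Q%:R.
  have := floor_itv (x z i); rewrite intrD => /andP[f1 f2].
  rewrite mulr_ge0 ?subr_ge0//= -[ltRHS]mulr1 ltr_pM2l//; lra.
have trQ z i : (Num.truncn (fr z i) < Q)%N.
  by have /andP[f0 fQ] := fr0 z i; rewrite truncn_lt_nat.
pose b z : {ffun 'I_d -> 'I_Q} := [ffun i => Ordinal (trQ z i)].
have bP z i : ((b z) i)%:R <= fr z i < ((b z) i).+1%:R.
  by rewrite ffunE /=; apply: truncn_itv; have /andP[] := fr0 z i.
apply: (@le_trans _ _ (\sum_(z in G) \prod_i fejer_bound R Q (b z i))).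
  apply: ler_sum => z _; apply: ler_prod => i _; rewrite fejer_ge0.
  by apply: fejer_le_bound => //; exact: bP.
rewrite (partition_big b xpredT) //=.
apply: (@le_trans _ _ (\sum_(c : {ffun 'I_d -> 'I_Q})
    (\prod_i fejer_bound R Q (c i)) * N)).
  apply: ler_sum => c _.
  have pr0 : 0 <= \prod_i fejer_bound R Q (c i).
    by apply: prodr_ge0 => i _; exact: fejer_bound_ge0.
  apply: (@le_trans _ _ (\sum_(z in G | b z == c) \prod_i fejer_bound R Q (c i))).
    by apply: ler_sum => z /andP[_ /eqP ->].
  rewrite sumr_const -[leLHS]mulr_natr ler_wpM2l//; apply: le_trans (HN c).
  rewrite ler_nat; apply: subset_leq_card; apply/fintype.subsetP => z.
  rewrite !inE => /andP[zG /eqP <-]; rewrite zG /=.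
  by apply/forallP => i; exact: bP.
rewrite -mulr_suml ler_wpM2r//.
  by apply: le_trans (HN [ffun=> Ordinal Q0]); rewrite ler0n.
rewrite -(bigA_distr_bigA (fun (i : 'I_d) (c : 'I_Q) => fejer_bound R Q c)) /=.
rewrite prodr_const card_ord.
rewrite lerXn2r ?nnegrE ?sum_fejer_bound//.
  by apply: sumr_ge0 => *; exact: fejer_bound_ge0.
Qed.

(** * Counting *)

(** In the application the label [s z i] is a shifted integer part of a component of t.f', and [W]
    bounds how far apart boxes with equal labels can be. *)
Lemma card_code (d k B M W : nat) (J : 'I_k -> 'I_d)
    (A : {set {ffun 'I_d -> 'I_B}}) (s : {ffun 'I_d -> 'I_B} -> 'I_k -> nat) :
  injective J -> (0 < W)%N ->
  (forall z i, z \in A -> (s z i < M)%N) ->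
  (forall z z', z \in A -> z' \in A ->
     (forall l, (forall i, J i != l) -> z l = z' l) ->
     (forall i, s z i = s z' i) -> forall i, (z (J i) < z' (J i) + W)%N) ->
  (#|A| <= B ^ (d - k) * (M * W) ^ k)%N.
Proof.
move=> Jinj W0 sM HA.
have [->|[z0 z0A]] := set_0Vmem A; first by rewrite cards0.
(* For k > 0 a member of [A] gives M > 0, which the encoding below needs; for k = 0 the bound counts
   all functions. *)
have [k0|k0] := posnP k.
  rewrite k0 subn0 expn0 muln1.
  by apply: leq_trans (max_card _) _; rewrite card_ffun !card_ord.
have M0 : (0 < M)%N by exact: leq_trans (sM z0 (Ordinal k0) z0A).
case: M M0 sM => // M _ sM; case: W W0 HA => // W _ HA.
(* The coordinates of z in J are determined by their residues modulo W, once
   the other coordinates and [s z] are known. *)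
pose D := {l : 'I_d | l \notin codom J}.
pose code (z : {ffun 'I_d -> 'I_B}) : {ffun D -> 'I_B} * {ffun 'I_k -> 'I_M.+1 * 'I_W.+1} :=
  ([ffun l => z (val l)], [ffun i => (inord (s z i), inord (z (J i) %% W.+1))]).
have inj : {in A &, injective code}.
  move=> z z' zA z'A [/ffunP E1 /ffunP E2].
  have zz l : (forall i, J i != l) -> z l = z' l.
    move=> Jl; have lD : l \notin codom J.
      by apply/codomP => -[i lE]; have := Jl i; rewrite lE eqxx.
    by have := E1 (exist _ l lD); rewrite !ffunE.
  have ss i : s z i = s z' i.
    have := E2 i; rewrite !ffunE => -[/(congr1 val)/= + _].
    by rewrite !inordK// sM.
  have mm i : (z (J i) %% W.+1 = z' (J i) %% W.+1)%N.
    have := E2 i; rewrite !ffunE => -[_ /(congr1 val)/=].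
    by rewrite !inordK// ltn_pmod.
  apply/ffunP => l; have [/codomP[i ->]|lJ] := boolP (l \in codom J); last first.
    by apply: zz => i; apply: contraNneq lJ => <-; exact: codom_f.
  have h1 := HA z z' zA z'A zz ss i.
  have h2 := HA z' z z'A zA (fun l H => esym (zz l H)) (fun i => esym (ss i)) i.
  apply: val_inj => /=; move: h1 h2 (mm i).
  move: (nat_of_ord (z (J i))) (nat_of_ord (z' (J i))) => x y h1 h2 xy.
  have ex := divn_eq x W.+1; have ey := divn_eq y W.+1.
  rewrite ex ey xy; congr (_ * _ + _)%N; rewrite xy in ex.
  move: (x %/ _)%N (y %/ _)%N (y %% _)%N ex ey => u v r ex ey.
  have [uv|uv|//] := ltngtP u v.
    have : (u.+1 * W.+1 <= v * W.+1)%N by rewrite leq_mul2r uv orbT.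
    by rewrite mulSn; lia.
  have : (v.+1 * W.+1 <= u * W.+1)%N by rewrite leq_mul2r uv orbT.
  by rewrite mulSn; lia.
rewrite -(card_in_imset inj); apply: leq_trans (max_card _) _.
rewrite card_prod !card_ffun card_prod !card_ord card_sig.
have -> : #|[pred l | l \notin codom J]| = (d - k)%N; last by [].
have := cardC (mem (codom J)); rewrite card_codom// !card_ord => dE.
by move/(congr1 (subn^~ k)) : dE; rewrite addKn => <-; apply: eq_card.
Qed.

Lemma absz_shift_lt (u : int) (M : nat) :
  - M%:Z <= u -> u < M%:Z -> (`|(u + M%:Z)%R|%N < 2 * M)%N.
Proof. lia. Qed.

Lemma absz_shift_inj (u v : int) (M : nat) : - M%:Z <= u -> - M%:Z <= v ->
  `|(u + M%:Z)%R|%N = `|(v + M%:Z)%R|%N -> u = v.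
Proof. lia. Qed.

(** Counts the boxes whose gradients t.f' fall into one given window modulo 1; the factor L^-k is
    the saving over all boxes. Per direction of [J] there are O(|t|) integer parts and, up to
    constants, [Th] = q / (L^2 |t|) box indices for each, so |t| cancels. *)
Lemma cell_count (R : realType) (d m k : nat) (C : R) : 1 <= C ->
  exists2 K : R, 0 < K &
  forall (Om : set 'rV[R]_d) (Gr : 'I_m -> 'I_d -> 'rV[R]_d -> R) (t : 'rV[R]_m)
    (I J : 'I_k -> 'I_d) (q L B : nat) (c : 'I_d -> R)
    (al : {ffun 'I_d -> 'I_B} -> 'rV[R]_d) (A : {set {ffun 'I_d -> 'I_B}})
    (b : 'I_d -> nat),
  (forall x l i, Om x -> `|Gr l i x| <= C) -> 1 <= `|t| -> injective J ->
  (forall x y, Om x -> Om y -> forall Y Z : R, 0 <= Y -> 0 <= Z ->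
    (forall i, `|\sum_l t 0 l * Gr l (I i) x - \sum_l t 0 l * Gr l (I i) y|
       <= `|t| * Y) ->
    (forall l, (forall i, J i != l) -> `|x 0 l - y 0 l| <= Z) ->
    `|x - y| <= C * (Y + Z)) ->
  (0 < q)%N -> (0 < L)%N ->
  L%:R ^+ 2 * `|t| <= C * q%:R -> L%:R * B%:R <= C * q%:R ->
  (forall z, z \in A -> Om (al z)) ->
  (forall z i, z \in A -> `|q%:R * al z 0 i - c i - L%:R * (z i)%:R| <= 2 * L%:R) ->
  (forall z i, z \in A -> let u := \sum_l t 0 l * Gr l i (al z) in
     (b i)%:R <= (2 * L)%:R * (u - (Num.floor u)%:~R) < (b i).+1%:R) ->
  #|A|%:R * L%:R ^+ d <= K * q%:R ^+ d / L%:R ^+ k.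
Proof.
move=> C1; have C0 : 0 < C by lra.
(* [C3 * Th] bounds the difference of two box indices: it dominates C * Th / 2 + 4 * C + 4 because 1
   <= C * Th. [K1] multiplies the bounds for 2 * M0 relative to |t| and for [W] relative to [Th]. *)
pose C3 := C + (4 * C + 4) * C.
pose K1 := 2 * (m%:R * C + 1) * (C3 + C).
have C30 : 0 < C3 by rewrite addr_gt0// mulr_gt0//; lra.
have mC0 : 0 <= m%:R * C by rewrite mulr_ge0// ltW.
have mC1 : 0 < m%:R * C + 1 by rewrite ltr_wpDl.
have K10 : 0 < K1 by rewrite mulr_gt0 ?(addr_gt0 C30 C0)// mulr_gt0.
exists (C ^+ d * K1 ^+ k); first by rewrite mulr_gt0 ?exprn_gt0.
move=> Om Gr t I J q L B c al A b GrC t1 Jinj Hexp q0 L0 LtC LBC OmA alA bA.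
have t0 : 0 < `|t| by lra.
have qR : 0 < q%:R :> R by rewrite ltr0n.
have LR : 0 < L%:R :> R by rewrite ltr0n.
set Th := q%:R / (L%:R ^+ 2 * `|t|).
have Lt0 : 0 < L%:R ^+ 2 * `|t| by rewrite mulr_gt0 ?exprn_gt0.
have Th0 : 0 < Th by rewrite divr_gt0.
have Th1 : 1 <= C * Th by rewrite /Th mulrA ler_pdivlMr// mul1r.
pose x z i := \sum_l t 0 l * Gr l i (al z).
have xb z i : z \in A -> `|x z i| <= m%:R * C * `|t|.
  move=> zA; apply: le_trans (ler_norm_sum _ _ _) _.
  apply: (@le_trans _ _ (\sum_(l < m) `|t| * C)).
    apply: ler_sum => l _; rewrite normrM ler_pM ?coord_le_norm//.
    by apply: GrC; exact: OmA.
  by rewrite sumr_const card_ord -[leLHS]mulr_natl mulrA mulrAC.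
pose M0 := (Num.truncn (m%:R * C * `|t|)).+1.
pose W := (Num.truncn (C3 * Th)).+1.
pose s z i := `|(Num.floor (x z (I i)) + M0%:Z)%R|%N.
have mCt0 : 0 <= m%:R * C * `|t| by rewrite mulr_ge0.
have fl z i : z \in A -> (- M0%:Z <= Num.floor (x z (I i))) /\ (Num.floor (x z (I i)) < M0%:Z).
  move=> zA; have := xb z (I i) zA; rewrite ler_norml => /andP[h1 h2].
  have h3 : m%:R * C * `|t| < M0%:R.
    by have /andP[] := truncn_itv mCt0.
  split.
    by rewrite floor_ge_int rmorphN /=; apply: le_trans h1; rewrite lerN2 ltW.
  by rewrite floor_lt_int; apply: le_lt_trans h3.
have cardA : (#|A| <= B ^ (d - k) * ((2 * M0) * W) ^ k)%N.
  apply: (@card_code _ _ _ _ _ J A s) => //.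
    by move=> z i zA; have [] := fl z i zA; exact: absz_shift_lt.
  move=> z z' zA z'A zz ss i.
  have LRN : L%:R != 0 :> R by rewrite gt_eqF.
  have tN : `|t| != 0 by rewrite gt_eqF.
  have qN : q%:R != 0 :> R by rewrite gt_eqF.
  (* Equal integer parts and equal windows bound the gradient increment by 1 / (2L); equal box
     indices bound q times the increment of a coordinate outside [J] by 4L. *)
  have dist : `|al z - al z'| <= C * ((2 * L%:R * `|t|)^-1 + 4 * L%:R / q%:R).
    apply: (Hexp _ _ (OmA z zA) (OmA z' z'A)).
    - by rewrite invr_ge0 !mulr_ge0.
    - by rewrite divr_ge0// mulr_ge0.
    - move=> i'; rewrite -/(x z (I i')) -/(x z' (I i')).
      have ff : Num.floor (x z (I i')) = Num.floor (x z' (I i')).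
        apply: absz_shift_inj (ss i').
          by have [] := fl z i' zA.
        by have [] := fl z' i' z'A.
      have := bA z (I i') zA; have := bA z' (I i') z'A.
      rewrite /= -/(x z (I i')) -/(x z' (I i')) ff natrM -natr1.
      set F := _%:~R; set bb := _%:R => /andP[u1 u2] /andP[u3 u4].
      have -> : `|t| * (2 * L%:R * `|t|)^-1 = (2 * L%:R)^-1.
        by field; rewrite LRN tN.
      rewrite -[leRHS]mul1r ler_pdivlMr ?mulr_gt0//.
      have -> : `|x z (I i') - x z' (I i')| * (2 * L%:R) =
          `|(x z (I i') - x z' (I i')) * (2 * L%:R)|.
        by rewrite normrM [`|2 * _|]gtr0_norm// mulr_gt0.
      by rewrite ler_norml; apply/andP; split; lra.
    - move=> l lJ; rewrite ler_pdivlMr//.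
      have -> : `|al z 0 l - al z' 0 l| * q%:R = `|q%:R * al z 0 l - q%:R * al z' 0 l|.
        by rewrite -mulrBr normrM gtr0_norm// mulrC.
      have := alA z l zA; have := alA z' l z'A; rewrite (zz l lJ) !ler_norml.
      by move=> /andP[? ?] /andP[? ?]; apply/andP; split; lra.
  rewrite -(ltr_nat R) natrD -ltrBlDl.
  apply: (@le_lt_trans _ _ (C3 * Th)); last first.
    have CT0 : 0 <= C3 * Th by rewrite mulr_ge0// ltW.
    by have /andP[] := truncn_itv CT0.
  have := alA z (J i) zA; have := alA z' (J i) z'A; rewrite !ler_norml.
  move=> /andP[h1 h2] /andP[h3 h4].
  have h5 := coord_le_norm (al z - al z') (J i).
  rewrite !mxE ler_norml in h5; move/andP: h5 => [h5 h6].
  have h7 : al z 0 (J i) - al z' 0 (J i) <= C * ((2 * L%:R * `|t|)^-1 + 4 * L%:R / q%:R).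
    exact: le_trans dist.
  have h8 : q%:R * (al z 0 (J i) - al z' 0 (J i)) <=
      q%:R * (C * ((2 * L%:R * `|t|)^-1 + 4 * L%:R / q%:R)) by rewrite ler_pM2l.
  have h9 : L%:R * ((z (J i))%:R - (z' (J i))%:R) <=
      L%:R * (C * Th / 2 + 4 * C + 4).
    have -> : L%:R * (C * Th / 2 + 4 * C + 4) =
       q%:R * (C * ((2 * L%:R * `|t|)^-1 + 4 * L%:R / q%:R)) + 4 * L%:R.
      by rewrite /Th; field; rewrite LRN tN qN.
    by rewrite mulrBr in h8; lra.
  rewrite ler_pM2l// in h9; apply: le_trans h9 _.
  rewrite /C3; have := ler_wpM2l (_ : 0 <= 4 * C + 4) Th1.
  rewrite mulr1 => h10.
  have : 4 * C + 4 <= (4 * C + 4) * (C * Th) by apply: h10; lra.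
  have : 0 <= C * Th by rewrite mulr_ge0// ltW.
  by lra.
have kd : (k <= d)%N by have := leq_card J Jinj; rewrite !card_ord.
have MW : L%:R * ((2 * M0) * W)%N%:R <= K1 * q%:R / L%:R :> R.
  have hM : (2 * M0)%:R <= 2 * (m%:R * C + 1) * `|t|.
    have tr : (Num.truncn (m%:R * C * `|t|))%:R <= m%:R * C * `|t| by rewrite truncn_le.
    rewrite natrM /M0 -[(Num.truncn _).+1%:R]natr1.
    by move: tr; set u := _%:R; lra.
  have hW : W%:R <= (C3 + C) * Th.
    have tr : (Num.truncn (C3 * Th))%:R <= C3 * Th.
      by rewrite truncn_le mulr_ge0// ltW.
    by rewrite /W -[(Num.truncn _).+1%:R]natr1 (mulrDl C3 C Th) lerD.
  have -> : K1 * q%:R / L%:R = L%:R * ((2 * (m%:R * C + 1) * `|t|) * ((C3 + C) * Th)).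
    by rewrite /K1 /Th; field; rewrite !gt_eqF.
  by rewrite natrM ler_wpM2l// ler_pM.
clearbody K1.
apply: (@le_trans _ _ ((B ^ (d - k) * ((2 * M0) * W) ^ k)%N%:R * L%:R ^+ d)).
  by rewrite ler_wpM2r ?exprn_ge0// ler_nat.
rewrite natrM !natrX.
have -> : L%:R ^+ d = L%:R ^+ (d - k) * L%:R ^+ k :> R by rewrite -exprD subnK.
rewrite mulrACA -!exprMn [B%:R * _]mulrC [(_ * W)%N%:R * _]mulrC.
apply: (@le_trans _ _ ((C * q%:R) ^+ (d - k) * (K1 * q%:R / L%:R) ^+ k)).
  rewrite ler_pM ?exprn_ge0 ?mulr_ge0//.
    by rewrite lerXn2r ?nnegrE ?mulr_ge0// ltW.
  have K1q : 0 <= K1 * q%:R / L%:R by rewrite divr_ge0// mulr_ge0// ltW.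
  by rewrite lerXn2r ?nnegrE// mulr_ge0.
rewrite !exprMn exprVn.
have -> : q%:R ^+ d = q%:R ^+ (d - k) * q%:R ^+ k :> R by rewrite -exprD subnK.
rewrite (_ : C ^+ (d - k) * q%:R ^+ (d - k) * (K1 ^+ k * q%:R ^+ k / L%:R ^+ k) =
  C ^+ (d - k) * K1 ^+ k * (q%:R ^+ (d - k) * q%:R ^+ k) / L%:R ^+ k); last by ring.
rewrite ler_wpM2r ?invr_ge0 ?exprn_ge0// ler_wpM2r ?mulr_ge0 ?exprn_ge0//.
by rewrite ler_wpM2r ?exprn_ge0 ?(ltW K10)// ler_weXn2l// leq_subr.
Qed.

(** An eighth of a turn is the angle pi / 4. *)
Lemma cos_near_int_ge (R : realType) (x : R) (n : int) :
  `|x - n%:~R| <= 1 / 8 -> 1 / 2 <= cos (pi *+ 2 * x).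
Proof.
move=> xn; have -> : x = (x - n%:~R) + n%:~R by rewrite subrK.
rewrite mulrDr cos_period; set y := x - _ in xn *.
have p2 := pi_ge2 R.
have -> : cos (pi *+ 2 * y) = cos (pi *+ 2 * `|y|).
  by case: (ger0P y) => // _; rewrite mulrN cosN.
apply: cos_pi4_ge; have := normr_ge0 y; move: (`|y|) xn => z z8 z0.
by rewrite mulr2n; apply/andP; split; nra.
Qed.

(** L is sqrt(delta q) rounded up to an integer larger than it. The hypothesis reads 1 <= delta^(2m)
    (delta q)^k: it forces delta q >= 1, so rounding costs at most a factor 2, and its square root
    gives L^-k <= delta^m. *)
Lemma level_scale (R : realType) (m k q : nat) (delta : R) :
  (0 < k)%N -> (0 < q)%N -> 0 < delta <= 1 ->
  1 <= delta ^+ (2 * m + k) * q%:R ^+ k ->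
  exists L : nat, [/\ (0 < L)%N, L%:R ^+ 2 <= 4 * delta * q%:R, (L <= 2 * q)%N &
    L%:R ^- k <= delta ^+ m].
Proof.
move=> k0 q0 /andP[d0 d1] dq; have qR : 1 <= q%:R :> R by rewrite ler1n.
have dqk : 1 <= delta ^+ m ^+ 2 * (delta * q%:R) ^+ k.
  by rewrite exprMn mulrA -exprM -exprD [(m * 2)%N]mulnC.
have dm1 : delta ^+ m ^+ 2 <= 1 by rewrite -exprM exprn_ile1// ltW.
have dq0 : 0 < delta * q%:R by rewrite mulr_gt0//; lra.
have dq1 : 1 <= delta * q%:R.
  rewrite leNgt; apply/negP => lt1; have : (delta * q%:R) ^+ k < 1.
    by rewrite exprn_ilt1 -?lt0n// ltW.
  have : 0 < (delta * q%:R) ^+ k by rewrite exprn_gt0.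
  have : 0 <= delta ^+ m ^+ 2 by rewrite sqr_ge0.
  by nra.
set r := Num.sqrt (delta * q%:R).
have r2 : r ^+ 2 = delta * q%:R by rewrite sqr_sqrtr// ltW.
have r0 : 0 <= r by exact: sqrtr_ge0.
have r1 : 1 <= r by nra.
exists (Num.truncn r).+1.
have /andP[t1 t2] := truncn_itv r0.
have L2 : (Num.truncn r).+1%:R ^+ 2 <= 4 * delta * q%:R :> R.
  by rewrite -natr1; have : 0 <= (Num.truncn r)%:R :> R by []; nra.
split=> //.
  rewrite -(ler_nat R) natrM; have : 0 <= (Num.truncn r).+1%:R :> R by [].
  move: L2; set l := _%:R; nra.
have Lk : delta * q%:R <= (Num.truncn r).+1%:R ^+ 2.
  by rewrite -r2 ler_sqr ?nnegrE// ltW.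
set l := (Num.truncn r).+1%:R in Lk *.
have l0 : 0 < l by rewrite ltr0n.
rewrite -div1r ler_pdivrMr ?exprn_gt0//.
rewrite -(@ler_sqr _ 1) ?nnegrE ?mulr_ge0 ?exprn_ge0 ?(ltW l0) ?(ltW d0)//.
rewrite expr1n exprMn; apply: le_trans dqk _.
rewrite ler_wpM2l ?sqr_ge0// exprAC lerXn2r ?nnegrE ?exprn_ge0 ?(ltW dq0) ?(ltW l0)//.
Qed.

(** In one coordinate at most 2q + 3 integers are covered by intervals of length L, and 2q + 3 + L
    <= 7q. *)
Lemma cell_number_le (q L : nat) : (0 < q)%N -> (L <= 2 * q)%N ->
  (L * ((2 * q + 3) %/ L + 1) <= 7 * q)%N.
Proof. by move=> q0 Lq; have := leq_trunc_div (2 * q + 3) L; lia. Qed.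

Lemma absz_subK (u v : int) : 0 <= u - v -> u = v + `|u - v|%N%:Z.
Proof. lia. Qed.

Lemma absz_le_of_lt (u : int) (n : nat) : 0 <= u -> u < n%:Z -> (`|u|%N <= n)%N.
Proof. lia. Qed.

Lemma int_ge0_gtN1 (u : int) : -1 < u -> 0 <= u.
Proof. lia. Qed.

Lemma card_set_pair (A B : finType) (P : {set A * B}) :
  #|P| = (\sum_a #|[set b | (a, b) \in P]%SET|)%N.
Proof.
rewrite -sum1_card big_mkcond /=.
transitivity (\sum_a \sum_b (if (a, b) \in P then 1 else 0))%N.
  by rewrite pair_bigA /=; apply: eq_bigr => -[].
apply: eq_bigr => a _; rewrite -sum1_card [RHS]big_mkcond /=.
by apply: eq_bigr => b _; rewrite inE.
Qed.

Lemma sum_pair_diag (R : numDomainType) (I : finType) (x y : R) :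
  \sum_(j : I) \sum_(j' : I) ((if j == j' then x else 0) + y) =
  #|I|%:R * x + #|I|%:R ^+ 2 * y.
Proof.
have -> : \sum_(j : I) \sum_(j' : I) ((if j == j' then x else 0) + y) =
    \sum_(j : I) (x + #|I|%:R * y).
  apply: eq_bigr => j _; rewrite big_split /= -big_mkcond /= (big_pred1 j).
    by rewrite sumr_const -[y *+ _]mulr_natl.
  by move=> i; rewrite eq_sym.
by rewrite sumr_const -[LHS]mulr_natl; ring.
Qed.

(** Division of the Fourier inequality by L^d T^(2m) / 4: [a] stands for L^d, [tau] for T^m, [bd]
    for the number B^d of boxes, [N] for the number of boxes in one window. *)
Lemma level_final_bound (R : realFieldType) (a tau X bd N A1 A2 e nu : R) :
  0 < a -> 0 < tau -> 0 <= A1 -> 0 <= A2 ->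
  a * X * (tau / 2) ^+ 2 <= tau * (A1 * a ^+ 2 * bd) + tau ^+ 2 * (A2 * a ^+ 2 * N) ->
  a * bd <= e -> a * N <= nu ->
  X <= 4 * A1 * e * tau^-1 + 4 * A2 * nu.
Proof.
move=> a0 t0 A10 A20 H He Hn.
have at0 : 0 < a * tau ^+ 2 by rewrite mulr_gt0 ?exprn_gt0.
apply: (@le_trans _ _ (4 * A1 * (a * bd) * tau^-1 + 4 * A2 * (a * N))); last first.
  by rewrite lerD ?ler_wpM2r ?ler_wpM2l ?invr_ge0 ?mulr_ge0 ?(ltW t0).
rewrite -(ler_pM2r at0).
have -> : (4 * A1 * (a * bd) / tau + 4 * A2 * (a * N)) * (a * tau ^+ 2) =
  4 * (tau * (A1 * a ^+ 2 * bd) + tau ^+ 2 * (A2 * a ^+ 2 * N)).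
  by field; rewrite gt_eqF.
have -> : X * (a * tau ^+ 2) = 4 * (a * X * (tau / 2) ^+ 2) by field.
by rewrite ler_pM2l.
Qed.

(** Only p is listed, since p alone locates alpha up to delta / q; p' merely witnesses that q
    f(alpha) - th2 is close to an integer point. [K] depends neither on q and delta nor on the
    shifts th1, th2. *)
Lemma level_count (R : realType) (d m k : nat) (C : R) : 1 <= C -> (0 < k)%N ->
  exists2 K : R, 0 < K &
  forall (Om : set 'rV[R]_d) (Gr : 'I_m -> 'I_d -> 'rV[R]_d -> R)
    (f : 'rV[R]_d -> 'rV[R]_m) (x0 : 'rV[R]_d),
  (forall x, Om x -> `|x - x0| <= 1) ->
  (forall x l i, Om x -> `|Gr l i x| <= C) ->
  (forall x y l, Om x -> Om y ->
    `|f x 0 l - f y 0 l - \sum_i Gr l i y * (x 0 i - y 0 i)| <= C * `|x - y| ^+ 2) ->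
  (forall t : 'rV[R]_m, t != 0 -> exists I J : 'I_k -> 'I_d, injective J /\
    forall x y, Om x -> Om y -> forall Y Z : R, 0 <= Y -> 0 <= Z ->
    (forall i, `|\sum_l t 0 l * Gr l (I i) x - \sum_l t 0 l * Gr l (I i) y|
       <= `|t| * Y) ->
    (forall l, (forall i, J i != l) -> `|x 0 l - y 0 l| <= Z) ->
    `|x - y| <= C * (Y + Z)) ->
  forall (q : nat) (delta : R) (th1 : 'rV[R]_d) (th2 : 'rV[R]_m),
  (0 < q)%N -> 0 < delta <= 1 -> 1 <= delta ^+ (2 * m + k) * q%:R ^+ k ->
  exists2 s : seq 'rV[int]_d, (size s)%:R <= K * q%:R ^+ d * delta ^+ m &
    forall x (p : 'rV[int]_d) (p' : 'rV[int]_m), Om x ->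
    (forall i, `|q%:R * x 0 i - th1 0 i - (p 0 i)%:~R| < delta) ->
    (forall l, `|q%:R * f x 0 l - th2 0 l - (p' 0 l)%:~R| < delta) ->
    p \in s.
Proof.
move=> C1 k0.
(* The 8 accommodates L^2 |t| <= 8 q and L B <= 7 q when [cell_count] is applied. *)
have C'1 : 1 <= C + 8 by lra.
have [Kc Kc0 HKc] := @cell_count R d m k _ C'1.
(* [C2 * delta] adds the distance from q f to p', the Taylor error q C (3L / q)^2 with L^2 <= 4
   delta q, and the effect of replacing q alpha by p + th1. With [c], the phase stays within 1/8 of
   an integer. *)
pose C2 := 1 + 9 * C * 4 + d%:R * C.
pose c := (8 * m.+1%:R * C2)^-1.
have dC0 : 0 <= d%:R * C by rewrite mulr_ge0//; lra.
have C20 : 1 <= C2 by rewrite /C2; lra.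
have c0 : 0 < c by rewrite invr_gt0 !mulr_gt0//; lra.
have m1 : 1 <= m.+1%:R :> R by rewrite ler1n.
have c1 : c <= 1 by rewrite invf_le1 ?mulr_gt0//; nra.
(* Diagonal plus off-diagonal contribution; 4 and 256 = 64 * 4 come from Fejer kernels of order 2L,
   c^-m from T >= c / delta. *)
exists (4 * 4 ^+ d * (C + 8) ^+ d * c ^- m + 4 * 256 ^+ d * Kc).
  by rewrite addr_gt0 ?mulr_gt0 ?invr_gt0 ?exprn_gt0//; lra.
move=> Om Gr f x0 Omx0 GrC fT expd q delta th1 th2 q0 d01 dq.
have [L [L0 L2 Lq Lk]] := level_scale k0 q0 d01 dq.
have /andP[d0 d1] := d01.
have qR : 1 <= q%:R :> R by rewrite ler1n.
have LR : 1 <= L%:R :> R by rewrite ler1n.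
(* Frequencies below T are at most c / delta, while T itself exceeds c / delta. *)
pose T := (Num.truncn (c / delta)).+1.
have cd0 : 0 <= c / delta by rewrite divr_ge0// ltW.
have /andP[T1 T2] := truncn_itv cd0.
have T3 : T%:R <= 2 / delta.
  rewrite /T -[(Num.truncn _).+1%:R]natr1; have : c / delta <= 1 / delta.
    by rewrite ler_wpM2r// invr_ge0 ltW.
  have : 1 <= 1 / delta by rewrite ler_pdivlMr// mul1r.
  by lra.
pose B := ((2 * q + 3) %/ L + 1)%N.
have LB : L%:R * B%:R <= (C + 8) * q%:R.
  have : (L * B <= 7 * q)%N by exact: cell_number_le.
  by rewrite -(ler_nat R) !natrM => /le_trans; apply; rewrite ler_wpM2r//; lra.
(* A lower corner for the integer points that can occur. Subtracting 1 makes room for delta <= 1;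
   together with the rounding this gives the range 2q + 3. *)
pose c0z i : int := Num.floor (q%:R * (x0 0 i - 1) - th1 0 i) - 1.
pose cell := {ffun 'I_d -> 'I_B}; pose off := {ffun 'I_d -> 'I_L}.
pose pt (bv : cell * off) : 'rV[int]_d :=
  \row_i (c0z i + (L * bv.1 i + bv.2 i)%:Z).
pose hit (x : 'rV[R]_d) (p : 'rV[int]_d) (p' : 'rV[int]_m) := [/\ Om x,
    forall i, `|q%:R * x 0 i - th1 0 i - (p 0 i)%:~R| < delta &
    forall l, `|q%:R * f x 0 l - th2 0 l - (p' 0 l)%:~R| < delta].
pose P : {set cell * off} :=
  [set bv | `[< exists x p', hit x (pt bv) p' >]]%SET.
exists [seq pt bv | bv <- enum P]; last first.
  move=> x p p' Omx hp hp'.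
  have bd i : (0 <= p 0 i - c0z i) /\ (p 0 i - c0z i < (2 * q + 3)%:Z).
    have := le_trans (coord_le_norm (x - x0) i) (Omx0 x Omx).
    rewrite !mxE ler_norml => /andP[h1 h2].
    have := hp i; rewrite ltr_norml => /andP[h3 h4].
    have /andP[h5 h6] := floor_itv (q%:R * (x0 0 i - 1) - th1 0 i).
    rewrite intrD in h6.
    have e1 : (c0z i)%:~R = (Num.floor (q%:R * (x0 0 i - 1) - th1 0 i))%:~R - 1 :> R.
      by rewrite /c0z intrD mulrN1z.
    have h7 : q%:R * (x0 0 i - 1) <= q%:R * x 0 i.
      by rewrite ler_wpM2l//; clear - h1; lra.
    have h8 : q%:R * x 0 i <= q%:R * (x0 0 i - 1) + 2 * q%:R by nra.
    split.
      suff : -1 < (p 0 i - c0z i)%:~R :> R.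
        by rewrite -[-1]/((-1)%:~R) ltr_int; exact: int_ge0_gtN1.
      by rewrite intrB e1; lra.
    suff : (p 0 i - c0z i)%:~R < ((2 * q + 3)%:Z)%:~R :> R by rewrite ltr_int.
    by rewrite intrB e1 -[((2 * q + 3)%:Z)%:~R]/((2 * q + 3)%:R) natrD natrM; lra.
  pose n i := `|(p 0 i - c0z i)%R|%N.
  have nE i : p 0 i = c0z i + (n i)%:Z by have [? _] := bd i; exact: absz_subK.
  have nB i : (n i %/ L < B)%N.
    by rewrite /B addn1 ltnS leq_div2r//; have [? ?] := bd i; exact: absz_le_of_lt.
  have nL i : (n i %% L < L)%N by rewrite ltn_mod.
  pose bv : cell * off := ([ffun i => Ordinal (nB i)], [ffun i => Ordinal (nL i)]).
  have pE : p = pt bv.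
    apply/rowP => i; rewrite mxE !ffunE /= nE; congr (_ + Posz _).
    by rewrite {1}(divn_eq (n i) L) mulnC.
  apply/mapP; exists bv => //; rewrite mem_enum inE; apply/asboolP.
  by exists x, p'; rewrite -pE.
rewrite size_map -cardE.
pose GV (z : cell) : {set off} := [set v | (z, v) \in P]%SET.
rewrite card_set_pair -/GV.
pose Good : {set cell} := [set z | GV z != finset.set0]%SET.
(* Each box is linearized at a point of [Om] that is hit there: the estimates hold on [Om] only,
   which need not contain the points suggested by the box itself. *)
have Hal z : exists a : 'rV[R]_d, z \in Good ->
    Om a /\ exists v p', hit a (pt (z, v)) p'.
  have [zG|zG] := boolP (z \in Good); last by exists 0.
  have /set0Pn[v] : GV z != finset.set0 by move: zG; rewrite inE.
  rewrite inE => zvP; have /asboolP[x [p' h]] :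
    `[< exists x p', hit x (pt (z, v)) p' >] by move: zvP; rewrite inE.
  by exists x => _; split; [case: h|exists v, p'].
have {Hal}[al Hal] := choice Hal.
have ptE z v i : (pt (z, v) 0 i)%:~R = (c0z i)%:~R + L%:R * (z i)%:R + (v i)%:R :> R.
  by rewrite mxE intrD -[(Posz _)%:~R]/(_%:R) natrD natrM addrA.
have vL (v : off) i : (0 <= (v i)%:R :> R) && ((v i)%:R <= L%:R - 1 :> R).
  by rewrite ler0n /= lerBrDr natr1 ler_nat ltn_ord.
have alc z i : z \in Good ->
    `|q%:R * al z 0 i - (th1 0 i + (c0z i)%:~R) - L%:R * (z i)%:R| <= 2 * L%:R.
  move=> /Hal[_ [v [p' [_ /(_ i) + _]]]]; rewrite ptE ltr_norml => /andP[h1 h2].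
  by have /andP[h3 h4] := vL v i; rewrite ler_norml; apply/andP; split; lra.
pose F (z : cell) (j j' : {ffun 'I_m -> 'I_T}) : R :=
  \prod_i fejer (2 * L) (\sum_l ((j l)%:R - (j' l)%:R) * Gr l i (al z)).
have cellF z : z \in Good -> L%:R ^+ d * #|GV z|%:R * (T%:R ^+ m / 2) ^+ 2 <=
    \sum_j \sum_j' F z j j'.
  move=> zG; have [Omz [v0 [p0 [_ h0 _]]]] := Hal z zG.
  (* At the offset v, the linearization of q f - th2 at [al z], taken where q alpha = p + th1, is y
     + f'(al z) v. *)
  pose y l := q%:R * f (al z) 0 l - th2 0 l + \sum_i Gr l i (al z) *
    (th1 0 i + (c0z i)%:~R + L%:R * (z i)%:R - q%:R * al z 0 i).
  apply: (@fourier_count R d m L T (fun l i => Gr l i (al z)) y) => v j.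
  rewrite inE => zvP; have /asboolP[x [p' [Omx hx hf]]] :
    `[< exists x p', hit x (pt (z, v)) p' >] by move: zvP; rewrite inE.
  have near l : `|y l + \sum_i Gr l i (al z) * (v i)%:R - (p' 0 l)%:~R| <= C2 * delta.
    pose eps i := q%:R * x 0 i - th1 0 i - (pt (z, v) 0 i)%:~R.
    pose err := f x 0 l - f (al z) 0 l - \sum_i Gr l i (al z) * (x 0 i - al z 0 i).
    have -> : y l + \sum_i Gr l i (al z) * (v i)%:R - (p' 0 l)%:~R =
       (q%:R * f x 0 l - th2 0 l - (p' 0 l)%:~R) - q%:R * err -
       \sum_i Gr l i (al z) * eps i.
      rewrite /y /err mulrBr mulr_sumr.
      have -> : \sum_i q%:R * (Gr l i (al z) * (x 0 i - al z 0 i)) =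
        \sum_i Gr l i (al z) * eps i + \sum_i Gr l i (al z) * (v i)%:R +
        \sum_i Gr l i (al z) *
          (th1 0 i + (c0z i)%:~R + L%:R * (z i)%:R - q%:R * al z 0 i).
        rewrite -!big_split /=; apply: eq_bigr => i _; rewrite /eps ptE; ring.
      by ring.
    have xal : `|x - al z| <= 3 * L%:R / q%:R.
      apply/rV_norm_leP => [|i]; first by rewrite divr_ge0// mulr_ge0.
      rewrite !mxE ler_pdivlMr; last by lra.
      have -> : `|x 0 i - al z 0 i| * q%:R = `|q%:R * x 0 i - q%:R * al z 0 i|.
        by rewrite -mulrBr normrM ger0_norm// mulrC.
      have := hx i; have := h0 i; rewrite !ptE !ltr_norml => /andP[? ?] /andP[? ?].
      have /andP[? ?] := vL v i; have /andP[? ?] := vL v0 i.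
      by rewrite ler_norml; apply/andP; split; lra.
    have qerr : `|q%:R * err| <= 9 * C * 4 * delta.
      rewrite normrM ger0_norm//.
      apply: (@le_trans _ _ (q%:R * (C * (3 * L%:R / q%:R) ^+ 2))).
        rewrite ler_wpM2l//; apply: le_trans (fT _ _ l Omx Omz) _.
        by rewrite ler_wpM2l ?ler_sqr ?nnegrE ?divr_ge0 ?mulr_ge0//; lra.
      have -> : q%:R * (C * (3 * L%:R / q%:R) ^+ 2) = 9 * C / q%:R * L%:R ^+ 2.
        by field; rewrite gt_eqF//; lra.
      apply: (@le_trans _ _ (9 * C / q%:R * (4 * delta * q%:R))).
        by rewrite ler_wpM2l// divr_ge0//; lra.
      rewrite le_eqVlt; apply/orP; left; apply/eqP; field.
      by rewrite gt_eqF//; lra.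
    have seps : `|\sum_i Gr l i (al z) * eps i| <= d%:R * (C * delta).
      apply: le_trans (ler_norm_sum _ _ _) _.
      apply: (@le_trans _ _ (\sum_(i < d) C * delta)).
        by apply: ler_sum => i _; rewrite normrM ler_pM ?GrC// ltW// hx.
      by rewrite sumr_const card_ord -[leLHS]mulr_natl.
    have := ltW (hf l); move: qerr seps; rewrite !ler_norml /C2.
    by move=> /andP[? ?] /andP[? ?] /andP[? ?]; apply/andP; split; lra.
  apply: (@cos_near_int_ge _ _ (\sum_l (j l)%:Z * p' 0 l)).
  have -> : (\sum_l (j l)%:Z * p' 0 l)%:~R = \sum_l (j l)%:R * (p' 0 l)%:~R :> R.
    by rewrite rmorph_sum; apply: eq_bigr => l _; exact: rmorphM.
  rewrite -sumrB; apply: le_trans (ler_norm_sum _ _ _) _.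
  apply: (@le_trans _ _ (\sum_(l < m) c / delta * (C2 * delta))).
    apply: ler_sum => l _; rewrite -mulrBr normrM ler_pM//.
    rewrite ger0_norm//; apply: le_trans T1; rewrite ler_nat.
    by have := ltn_ord (j l); rewrite ltnS.
  rewrite sumr_const card_ord -[leLHS]mulr_natl.
  have -> : c / delta * (C2 * delta) = c * C2 by field; rewrite gt_eqF.
  apply: (@le_trans _ _ (m.+1%:R * (c * C2))).
    by rewrite ler_wpM2r ?ler_nat// mulr_ge0 ?(ltW c0)//; lra.
  rewrite le_eqVlt; apply/orP; left; apply/eqP; rewrite /c; field.
  by rewrite !gt_eqF//; lra.
pose N := Kc * q%:R ^+ d / L%:R ^+ k / L%:R ^+ d.
have N0 : 0 <= N by rewrite !mulr_ge0 ?invr_ge0 ?exprn_ge0 ?(ltW Kc0).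
have L1d : 0 < L%:R ^+ d :> R by rewrite exprn_gt0//; lra.
have offdiag (j j' : {ffun 'I_m -> 'I_T}) : j != j' ->
    \sum_(z in Good) F z j j' <= (64 * (2 * L)%:R ^+ 2) ^+ d * N.
  move=> jj'; pose t : 'rV[R]_m := \row_l ((j l)%:R - (j' l)%:R).
  have t1 : 1 <= `|t|.
    have : [exists l, j l != j' l].
      rewrite -negb_forall; apply: contra jj' => /forallP H.
      by apply/eqP/ffunP => l; apply/eqP.
    move=> /existsP[l jl]; apply: le_trans (coord_le_norm t l); rewrite mxE.
    have -> : (j l)%:R - (j' l)%:R = ((j l)%:Z - (j' l)%:Z)%:~R :> R.
      by rewrite intrB.
    rewrite -intr_norm -[1]/(1%:~R) ler_int -gtz0_ge1 normr_gt0 subr_eq0.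
    by apply: contra jl => /eqP[] /val_inj ->.
  have tN : t != 0 by rewrite -normr_gt0; lra.
  have tT : `|t| <= T%:R.
    apply/rV_norm_leP => // l; rewrite mxE ler_norml.
    have := ltn_ord (j l); have := ltn_ord (j' l).
    rewrite -!(ltr_nat R) => ? ?.
    have : 0 <= (j l)%:R :> R by []. have : 0 <= (j' l)%:R :> R by [].
    by move=> ? ?; apply/andP; split; lra.
  have [I [J [Jinj HIJ]]] := expd t tN.
  apply: fejer_sum_count; first by rewrite muln_gt0.
  move=> b; rewrite /N ler_pdivlMr//.
  apply: (@HKc Om Gr t I J q L B (fun i => th1 0 i + (c0z i)%:~R) al _
    (fun i => nat_of_ord (b i))) => //.
  - by move=> x l i Ox; apply: le_trans (GrC x l i Ox) _; rewrite lerDl.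
  - move=> x y Ox Oy Y Z Y0 Z0 hY hZ; apply: le_trans (HIJ x y Ox Oy Y Z Y0 Z0 hY hZ) _.
    by rewrite ler_wpM2r ?addr_ge0// lerDl.
  - apply: (@le_trans _ _ (4 * delta * q%:R * (2 / delta))).
      by rewrite ler_pM// ?sqr_ge0// (le_trans tT).
    have -> : 4 * delta * q%:R * (2 / delta) = 8 * q%:R by field; rewrite gt_eqF.
    by rewrite ler_wpM2r//; lra.
  - by move=> z; rewrite inE => /andP[/Hal[]].
  - by move=> z i; rewrite inE => /andP[zG _]; exact: alc.
  - move=> z i; rewrite inE => /andP[_ /forallP/(_ i)] /=.
    have -> : \sum_l t 0 l * Gr l i (al z) =
        \sum_l ((j l)%:R - (j' l)%:R) * Gr l i (al z).
      by apply: eq_bigr => l _; rewrite mxE.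
    by [].
pose D0 : R := ((2 * L)%:R ^+ 2) ^+ d * B%:R ^+ d.
(* All arguments of the kernels are 0 here, where the trivial bound (2L)^2 is attained. *)
have diag (j : {ffun 'I_m -> 'I_T}) : \sum_(z in Good) F z j j <= D0.
  apply: (@le_trans _ _ (\sum_(z in Good) ((2 * L)%:R ^+ 2) ^+ d)).
    apply: ler_sum => z _; rewrite /F -[in leRHS](card_ord d) -prodr_const.
    by apply: ler_prod => i _; rewrite fejer_ge0 fejer_le.
  rewrite sumr_const -[leLHS]mulr_natr /D0 ler_wpM2l ?exprn_ge0 ?sqr_ge0//.
  rewrite -natrX ler_nat; apply: leq_trans (max_card _) _.
  by rewrite card_ffun !card_ord.
pose OD : R := (64 * (2 * L)%:R ^+ 2) ^+ d * N.
have OD0 : 0 <= OD by apply: mulr_ge0 => //; rewrite exprn_ge0// mulr_ge0// sqr_ge0.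
pose tau : R := T%:R ^+ m.
have tau0 : 0 < tau by rewrite exprn_gt0// ltr0n.
pose X : R := (\sum_z #|GV z|)%N%:R.
have main : L%:R ^+ d * X * (tau / 2) ^+ 2 <= tau * D0 + tau ^+ 2 * OD.
  have -> : X = \sum_(z in Good) #|GV z|%:R.
    rewrite /X natr_sum (bigID (mem Good)) /= [X in _ + X]big1 ?addr0// => z.
    by rewrite inE negbK => /eqP ->; rewrite cards0.
  rewrite mulr_sumr mulr_suml.
  apply: (@le_trans _ _ (\sum_(z in Good) \sum_j \sum_j' F z j j')).
    by apply: ler_sum => z zG; exact: cellF.
  rewrite exchange_big /=.
  apply: (@le_trans _ _ (\sum_(j : {ffun 'I_m -> 'I_T})
      \sum_(j' : {ffun 'I_m -> 'I_T}) ((if j == j' then D0 else 0) + OD))).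
    apply: ler_sum => j _; rewrite exchange_big /=; apply: ler_sum => j' _.
    have [<-|jj'] := eqVneq j j'; first by rewrite ler_wpDr// diag.
    by rewrite add0r offdiag.
  by rewrite sum_pair_diag card_ffun !card_ord natrX.
clearbody c.
have m0 : 0 < c / delta by rewrite divr_gt0.
have tauV : tau^-1 <= c ^- m * delta ^+ m.
  have -> : c ^- m * delta ^+ m = ((c / delta) ^+ m)^-1.
    by rewrite exprMn exprVn invfM invrK.
  rewrite lef_pV2.
  - by rewrite lerXn2r ?nnegrE ?(ltW m0)// ltW.
  - by rewrite posrE exprn_gt0// ltr0n.
  - by rewrite posrE exprn_gt0.
pose e : R := (C + 8) ^+ d * q%:R ^+ d.
pose nu : R := Kc * q%:R ^+ d * delta ^+ m.
have e0 : 0 <= e by rewrite mulr_ge0 ?exprn_ge0//; lra.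
apply: (@le_trans _ _ (4 * 4 ^+ d * e * tau^-1 + 4 * 256 ^+ d * nu)).
  apply: (@level_final_bound R (L%:R ^+ d) tau X (B%:R ^+ d) N) => //.
  - have E (x : R) : (x * L%:R ^+ 2) ^+ d = x ^+ d * (L%:R ^+ d) ^+ 2.
      by rewrite exprMn exprAC.
    have E4 : (2 * L)%:R ^+ 2 = 4 * L%:R ^+ 2 :> R by rewrite natrM; ring.
    have E256 : 64 * (4 * L%:R ^+ 2) = 256 * L%:R ^+ 2 :> R by ring.
    by move: main; rewrite /D0 /OD E4 E256 !E.
  - by rewrite -exprMn /e -exprMn lerXn2r ?nnegrE ?mulr_ge0//; lra.
  - by rewrite /N mulrC mulfVK ?gt_eqF// /nu ler_wpM2l// mulr_ge0 ?exprn_ge0// ltW.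
rewrite [leRHS](_ : _ = 4 * 4 ^+ d * e * (c ^- m * delta ^+ m) +
    4 * 256 ^+ d * nu); last by rewrite /e /nu; move: (c ^- m) => w; ring.
by rewrite lerD2r ler_wpM2l// mulr_ge0// mulr_ge0// exprn_ge0.
Qed.

(** * The convergence theorem *)

(** Values on ]0, +oo[ dominate the right limit 0; the value at 0 follows by continuity. *)
Lemma dimension_function_ge0 (R : realType) (g : R -> R) (r : R) :
  dimension_function g -> 0 <= r -> 0 <= g r.
Proof.
move=> [g1 g2 g3]; have pos s : 0 < s -> 0 <= g s.
  move=> s0; rewrite -(cvg_lim _ g3)//; apply: limr_le; first by apply/cvg_ex; exists 0.
  near=> u; have u0 : 0 < u by near: u; exact: nbhs_right_gt.
  have us : u < s by near: u; exact: nbhs_right_lt.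
  by apply: g1; rewrite ?in_itv/= ?andbT ?ltW.
rewrite le_eqVlt => /orP[/eqP <-|/pos//].
rewrite leNgt; apply/negP => g00.
have e0 : 0 < - g 0 / 2 by rewrite divr_gt0// oppr_gt0.
have z0 : `[0, +oo[%classic (0 : R) by rewrite /= in_itv/= lexx.
have /within_continuous_epsP/(_ _ z0 _ e0)[r' r'0 Hr] := g2.
have := Hr (r' / 2); rewrite /= in_itv/= andbT sub0r normrN gtr0_norm ?divr_gt0//.
have r2 : 0 < r' / 2 by rewrite divr_gt0.
have r2r : r' / 2 < r' by lra.
move=> /(_ (ltW r2) r2r).
have := pos _ r2; move=> gr; rewrite ler_norml => /andP[gl _].
by lra.
Unshelve. all: by end_near. Qed.

Lemma gbar_monotone_gauge (R : realType) (m : nat) (g : R -> R) :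
  (0 < m)%N -> dimension_function g ->
  {in `]0, +oo[ &, {homo gbar m g : x y / x <= y}} -> monotone_gauge (gbar m g).
Proof.
move=> m0 hg hgb; split.
(* Since m > 0, the quotient at 0 is 0 by the convention 0^-1 = 0. *)
- by rewrite /gbar expr0n eqn0Ngt m0 invr0 mulr0.
- by move=> r r0; rewrite divr_ge0 ?exprn_ge0 ?(ltW r0)// dimension_function_ge0// ltW.
- move=> r s r0 rs; apply: hgb => //; rewrite in_itv/= andbT//.
  exact: lt_le_trans rs.
Qed.

Lemma infinite_nat_unbounded (A : set nat) (Q : nat) :
  infinite_set A -> exists2 q, A q & (Q <= q)%N.
Proof.
move=> Ainf; apply: contrapT => H; apply: Ainf.
apply: (@sub_finite_set _ _ `I_Q); last exact: finite_II.
move=> q Aq /=; rewrite ltnNge; apply/negP => Qq; apply: H.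
by exists q.
Qed.

(** Capping at 1 loses nothing: rounding down is always at distance less than 1. It makes radii
    delta <= 1 available. *)
Lemma dist_int_lt_cap (R : realType) n (x : 'rV[R]_n) (psi delta : R) :
  dist_int x < psi -> 0 < delta -> Num.min psi 1 <= delta ->
  exists p : 'rV[int]_n, forall i, `|x 0 i - (p 0 i)%:~R| < delta.
Proof.
move=> xpsi delta0 pd; have [psi1|psi1] := leP psi 1.
  have [|_ [p _ <-] xp] := inf_lt _ xpsi.
    by exists `|x - map_mx intr 0|; exists 0.
  exists p => i; have := rV_norm_lt xp i; rewrite !mxE => /lt_le_trans; apply.
  by move: pd; rewrite (min_idPl psi1).
exists (\row_i Num.floor (x 0 i)) => i; rewrite mxE.
have /andP[h1 h2] := floor_itv (x 0 i); rewrite intrD in h2.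
move: pd; rewrite (min_idPr (ltW psi1)) => d1.
by rewrite ger0_norm ?subr_ge0//; lra.
Qed.

(** The power of exponent 2m + k of the function in (I), times q^k, is (ln q)^(2k), and ln q >= 1
    for q >= e. If the cap 1 is active, delta >= 1 and both factors are at least 1. *)
Lemma log_scale_ge (R : realType) (m k q : nat) (delta : R) :
  (0 < k)%N -> expR 1 <= q%:R :> R ->
  Num.min ((q%:R^-1 * ln q%:R ^+ 2) `^ (k%:R / (2 * m + k)%:R)) 1 <= delta ->
  1 <= delta ^+ (2 * m + k) * q%:R ^+ k.
Proof.
move=> k0 qe; set u := _ `^ _ => ud.
have q1 : 1 <= q%:R :> R by apply: le_trans qe; rewrite -[leLHS]expR0 ler_expR.
have lq : 1 <= ln q%:R :> R by rewrite -[1 in leLHS]expRK ler_ln ?posrE ?expR_gt0//; lra.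
have [u1|u1] := leP 1 u.
  move: ud; rewrite (min_idPr u1) => d1.
  by rewrite mulr_ege1 ?exprn_ege1.
move: ud; rewrite (min_idPl (ltW u1)) => d1.
have x0 : 0 <= q%:R^-1 * ln q%:R ^+ 2 :> R by rewrite mulr_ge0 ?invr_ge0 ?sqr_ge0.
have mk0 : (2 * m + k)%:R != 0 :> R by rewrite pnatr_eq0; lia.
have uE : u ^+ (2 * m + k) = (q%:R^-1 * ln q%:R ^+ 2) ^+ k.
  rewrite -powR_mulrn ?powR_ge0// -powRrM mulfVK// powR_mulrn//.
apply: (@le_trans _ _ (u ^+ (2 * m + k) * q%:R ^+ k)).
  rewrite uE -exprMn mulrAC mulVf ?mul1r ?exprn_ege1//.
  by rewrite gt_eqF//; lra.
rewrite ler_wpM2r ?exprn_ge0// lerXn2r ?nnegrE ?powR_ge0//.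
by apply: le_trans d1; rewrite powR_ge0.
Qed.

Lemma C2_map_bounds (R : realType) (d m : nat) (a b : 'rV[R]_d)
    (f : 'rV[R]_d -> 'rV[R]_m) : C2_map (rectangle a b) f ->
  exists2 C : R, 0 < C &
  [/\ forall x l i, rectangle a b x ->
        `|partial (rectangle a b) i (fun y => f y 0 l) x| <= C,
      forall x y l, rectangle a b x -> rectangle a b y ->
        `|f x 0 l - f y 0 l| <= C * `|x - y| &
      forall x y l, rectangle a b x -> rectangle a b y ->
        `|f x 0 l - f y 0 l - \sum_i partial (rectangle a b) i (fun y => f y 0 l) y
            * (x 0 i - y 0 i)| <= C * `|x - y| ^+ 2].
Proof.
move=> fC.
have [|[l i]|C1 C10 H1] := @finite_upper_bound R ('I_m * 'I_d)%type (fun li C =>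
    forall x, rectangle a b x ->
      `|partial (rectangle a b) li.2 (fun y => f y 0 li.1) x| <= C).
- by move=> [l i] C C' H CC' x Kx; exact: le_trans (H x Kx) CC'.
- by apply: rectangle_bounded; have [[_ /(_ i)[]]] := fC l.
have [|l|C2 C20 H2] := @finite_upper_bound R 'I_m (fun l C =>
    forall x y, rectangle a b x -> rectangle a b y ->
      `|f x 0 l - f y 0 l| <= C * `|x - y|).
- move=> l C C' H CC' x y Kx Ky; apply: le_trans (H x y Kx Ky) _.
  by rewrite ler_wpM2r.
- by have [fC1 _] := fC l; exact: C1_lipschitz fC1.
have [|l|C3 C30 H3] := @finite_upper_bound R 'I_m (fun l C =>
    forall x y, rectangle a b x -> rectangle a b y ->
      `|f x 0 l - f y 0 l - \sum_i partial (rectangle a b) i (fun y => f y 0 l) y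
            * (x 0 i - y 0 i)| <= C * `|x - y| ^+ 2).
- move=> l C C' H CC' x y Kx Ky; apply: le_trans (H x y Kx Ky) _.
  by rewrite ler_wpM2r// sqr_ge0.
- exact: C2_taylor (fC l).
exists (C1 + C2 + C3); first by rewrite !addr_gt0.
split=> [x l i Kx|x y l Kx Ky|x y l Kx Ky].
- by apply: le_trans (H1 (l, i) x Kx) _; lra.
- by apply: le_trans (H2 l x y Kx Ky) _; rewrite ler_wpM2r//; lra.
- by apply: le_trans (H3 l x y Kx Ky) _; rewrite ler_wpM2r ?sqr_ge0//; lra.
Qed.

(** The division by rho^m in [gbar] cancels the factor delta^m of the count: q^d delta^m gbar(delta
    / q) = q^(d+m) g(delta / q). Either of the two series then majorizes the term. *)
Lemma gauge_sum_le (R : realType) (d m : nat) (g : R -> R) (psi delta1 : nat -> R)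
    (delta : nat -> R) (size : nat -> nat) (C : R) (q0 : nat) :
  dimension_function g -> (0 < q0)%N -> 0 <= C ->
  (forall q, 0 <= psi q) -> (forall q, 0 <= delta1 q) ->
  (forall q, 0 < delta q) -> 
  (forall q, delta q <= psi q \/ delta q <= delta1 q) ->
  (forall q, (q < q0)%N -> size q = 0%N) ->
  (forall q, (q0 <= q)%N -> (size q)%:R <= C * q%:R ^+ d * delta q ^+ m) ->
  (\sum_(1 <= q <oo) (q%:R ^+ (d + m) * g (psi q / q%:R))%:E < +oo)%E ->
  (\sum_(1 <= q <oo) (q%:R ^+ (d + m) * g (delta1 q / q%:R))%:E < +oo)%E ->
  (\sum_(0 <= q <oo) ((size q)%:R *
     gbar m g (if (q0 <= q)%N then delta q / q%:R else 1))%:E < +oo)%E.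
Proof.
move=> hg q00 C0 psi0 d10 d0 dpsi s0 sC S1 S2.
have g0 r : 0 <= r -> 0 <= g r by exact: dimension_function_ge0.
have p1 q : (0 <= (q%:R ^+ (d + m) * g (psi q / q%:R))%:E)%E.
  by rewrite lee_fin mulr_ge0 ?exprn_ge0 ?g0// divr_ge0.
have p2 q : (0 <= (q%:R ^+ (d + m) * g (delta1 q / q%:R))%:E)%E.
  by rewrite lee_fin mulr_ge0 ?exprn_ge0 ?g0// divr_ge0.
have gq q : (q0 <= q)%N -> 0 <= gbar m g (delta q / q%:R).
  by move=> _; rewrite divr_ge0 ?exprn_ge0 ?g0// divr_ge0// ltW.
have pos q : (0 <= ((size q)%:R *
     gbar m g (if (q0 <= q)%N then delta q / q%:R else 1))%:E)%E.
  rewrite lee_fin mulr_ge0//; case: ifP => [|_]; first exact: gq.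
  by rewrite /gbar divr_ge0 ?exprn_ge0 ?g0.
rewrite (nneseries_split 0%N 1%N)// add0n big_nat1 s0// mul0r add0e.
apply: (@le_lt_trans _ _ (C%:E * (\sum_(1 <= q <oo) (q%:R ^+ (d + m) * g (psi q / q%:R))%:E +
  \sum_(1 <= q <oo) (q%:R ^+ (d + m) * g (delta1 q / q%:R))%:E))%E); last first.
  by rewrite lte_mul_pinfty// lte_add_pinfty.
rewrite -nneseriesD// -nneseriesZl; last by move=> q _; rewrite adde_ge0.
apply: lee_nneseries => // q q1.
rewrite -EFinD -EFinM lee_fin.
have [qq0|qq0] := leqP q0 q; last first.
  rewrite s0// mul0r; move: (p1 q) (p2 q); rewrite !lee_fin => ? ?.
  by rewrite mulr_ge0// addr_ge0.
have qR : 0 < q%:R :> R by rewrite ltr0n (leq_trans q00).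
apply: (@le_trans _ _ (C * q%:R ^+ d * delta q ^+ m * gbar m g (delta q / q%:R))).
  by rewrite ler_wpM2r ?gq// sC.
have -> : C * q%:R ^+ d * delta q ^+ m * gbar m g (delta q / q%:R) =
    C * (q%:R ^+ (d + m) * g (delta q / q%:R)).
  rewrite /gbar expr_div_n exprD; field.
  by rewrite !expf_neq0// gt_eqF.
rewrite ler_wpM2l// -mulrDr ler_wpM2l ?exprn_ge0//.
have [g1 _ _] := hg.
have mono u : delta q <= u -> g (delta q / q%:R) <= g (u / q%:R).
  move=> du; apply: g1; rewrite ?in_itv/= ?andbT ?divr_ge0// ?(ltW (d0 q))//.
    by rewrite (le_trans (ltW (d0 q)) du).
  by rewrite ler_wpM2r// invr_ge0.
have [/mono h|/mono h] := dpsi q; apply: le_trans h _.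
  by rewrite lerDl g0// divr_ge0.
by rewrite lerDr g0// divr_ge0.
Qed.

(** The radius [delta] is the larger of [psi] and [phi], both capped at 1: [phi] supplies the lower
    bound required by [level_count], and the convergence in (I) pays for this enlargement. *)
Lemma local_null (R : realType) (d m k : nat) (a b : 'rV[R]_d)
    (f : 'rV[R]_d -> 'rV[R]_m) (g : R -> R) (psi : nat -> R)
    (theta : 'rV[R]_(d + m)) (Om : set 'rV[R]_d) (x0 : 'rV[R]_d) (Lam : R) :
  let phi := fun q : nat => (q%:R^-1 * ln q%:R ^+ 2) `^ (k%:R / (2 * m + k)%:R) in
  (0 < m)%N -> (0 < k)%N -> C2_map (rectangle a b) f ->
  dimension_function g ->
  {in `]0, +oo[ &, {homo gbar m g : x y / x <= y}} ->
  (forall q, 0 < psi q) ->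
  (\sum_(1 <= q <oo) (q%:R ^+ (d + m) * g (psi q / q%:R))%:E < +oo)%E ->
  (\sum_(1 <= q <oo) (q%:R ^+ (d + m) * g (phi q / q%:R))%:E < +oo)%E ->
  Om `<=` rectangle a b -> (forall x, Om x -> `|x - x0| <= 1) -> 0 < Lam ->
  (forall t : 'rV[R]_m, t != 0 -> exists I J : 'I_k -> 'I_d, injective J /\
    forall x y, Om x -> Om y -> forall Y Z : R, 0 <= Y -> 0 <= Z ->
    (forall i, `|grad_dot a b f t (I i) x - grad_dot a b f t (I i) y| <= `|t| * Y) ->
    (forall l, (forall i, J i != l) -> `|x 0 l - y 0 l| <= Z) ->
    `|x - y| <= Lam * (Y + Z)) ->
  gauge_null (gbar m g)
    (Om `&` [set x | well_approximable psi theta (row_mx x (f x))]).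
Proof.
move=> phi m0 k0 fC hg hgb psi0 S1 S2 OmK Omx0 Lam0 expd.
have hh := gbar_monotone_gauge m0 hg hgb.
have [C C0 [B1 _ B3]] := C2_map_bounds fC.
pose C' := 1 + C + Lam.
have C'1 : 1 <= C' by rewrite /C'; lra.
have CC' : C <= C' by rewrite /C'; lra.
have LC' : Lam <= C' by rewrite /C'; lra.
have [K K0 HK] := @level_count R d m k C' C'1 k0.
have phi0 q : 0 <= phi q by rewrite powR_ge0.
pose delta q := Num.max (Num.min (psi q) 1) (Num.min (phi q) 1).
have d0 q : 0 < delta q by rewrite lt_max lt_min psi0 ltr01.
have d1 q : delta q <= 1 by rewrite ge_max !ge_min lexx !orbT.
(* From [q0] on, q >= e and hence ln q >= 1; the finitely many smaller q get empty families. *)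
pose q0 := (Num.truncn (expR 1 : R)).+1.
have qe q : (q0 <= q)%N -> expR 1 <= q%:R :> R.
  move=> qq; have /andP[_ h] := truncn_itv (expR_ge0 (1 : R)).
  by apply: le_trans (ltW h) _; rewrite ler_nat.
pose th1 : 'rV[R]_d := lsubmx theta; pose th2 : 'rV[R]_m := rsubmx theta.
pose Gr (l : 'I_m) (i : 'I_d) := partial (rectangle a b) i (fun y => f y 0 l).
have gd t i x : grad_dot a b f t i x = \sum_l t 0 l * Gr l i x.
  by apply: eq_bigr => l _; rewrite mxE.
have lev q : exists s : seq 'rV[int]_d, (q0 <= q)%N ->
    (size s)%:R <= K * q%:R ^+ d * delta q ^+ m /\
    forall x (p : 'rV[int]_d) (p' : 'rV[int]_m), Om x ->
    (forall i, `|q%:R * x 0 i - th1 0 i - (p 0 i)%:~R| < delta q) ->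
    (forall l, `|q%:R * f x 0 l - th2 0 l - (p' 0 l)%:~R| < delta q) ->
    p \in s.
  have [qq|_] := leqP q0 q; last by exists [::].
  have [s h1 h2] : exists2 s : seq 'rV[int]_d,
      (size s)%:R <= K * q%:R ^+ d * delta q ^+ m &
      forall x (p : 'rV[int]_d) (p' : 'rV[int]_m), Om x ->
      (forall i, `|q%:R * x 0 i - th1 0 i - (p 0 i)%:~R| < delta q) ->
      (forall l, `|q%:R * f x 0 l - th2 0 l - (p' 0 l)%:~R| < delta q) ->
      p \in s.
    apply: (HK Om Gr f x0) => //.
    - by move=> x l i Ox; apply: le_trans CC'; apply: B1; exact: OmK.
    - move=> x y l Ox Oy; apply: le_trans (B3 x y l (OmK _ Ox) (OmK _ Oy)) _.
      by rewrite ler_wpM2r ?sqr_ge0.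
    - move=> t tN; have [I [J [Jinj H]]] := expd t tN.
      exists I, J; split=> // x y Ox Oy Y Z Y0 Z0 hY hZ.
      apply: (@le_trans _ _ (Lam * (Y + Z))); last by rewrite ler_wpM2r ?addr_ge0.
      by apply: H => // i; rewrite !gd; exact: hY.
    - by apply: leq_trans qq.
    - by rewrite d0 d1.
    - by apply: log_scale_ge => //; [exact: qe|rewrite le_max lexx orbT].
  by exists s.
have {lev}[s0 Hs0] := choice lev.
pose s q := if (q0 <= q)%N then s0 q else [::].
(* The boxes have diameter up to 2 delta / q. They are halved so that g is evaluated at delta / q,
   where the series are known to converge. *)
have [N HN] := @diam_split R d 2 isT.
pose box q (p : 'rV[int]_d) : set 'rV[R]_d :=
  [set x | forall i, `|q%:R * x 0 i - th1 0 i - (p 0 i)%:~R| < delta q].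
have boxd q p : (q0 <= q)%N -> (diam (box q p) <= (2 * (delta q / q%:R))%:E)%E.
  move=> qq; have qR : 0 < q%:R :> R by rewrite ltr0n (leq_trans _ qq).
  apply/diam_leP => x y bx By; apply/rV_norm_leP => [|i].
    by rewrite mulr_ge0// divr_ge0// ltW.
  rewrite !mxE mulrA ler_pdivlMr//.
  have -> : `|x 0 i - y 0 i| * q%:R = `|q%:R * x 0 i - q%:R * y 0 i|.
    by rewrite -mulrBr normrM gtr0_norm// mulrC.
  have := bx i; have := By i; rewrite !ltr_norml => /andP[? ?] /andP[? ?].
  by rewrite ler_norml; apply/andP; split; lra.
have HP (qp : nat * 'rV[int]_d) : exists P : nat -> set 'rV[R]_d, (q0 <= qp.1)%N ->
    [/\ box qp.1 qp.2 `<=` \bigcup_j P j,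
        forall j, (N <= j)%N -> P j = set0 &
        forall j, (diam (P j) <= (delta qp.1 / qp.1%:R)%:E)%E].
  have [qq|_] := leqP q0 qp.1; last by exists (fun=> set0).
  have [P [P1 _ P3 P4]] := HN _ _ (boxd qp.1 qp.2 qq).
  exists P => _; split=> // j; apply: le_trans (P4 j) _.
  by rewrite lee_fin [2 * _]mulrC mulfK.
have {HP}[P HP] := choice HP.
pose L q := [seq (p, j) | p <- s q, j <- iota 0 N].
pose W q (pj : 'rV[int]_d * nat) := P (q, pj.1) pj.2.
(* Below [q0] the radius 1 is a positive placeholder for an empty family. *)
apply: (@gauge_null_limsup _ _ _ _ (fun q => [seq W q pj | pj <- L q])
  (fun q => if (q0 <= q)%N then delta q / q%:R else 1)) => //.
- move=> x [Ox wx] Q; have [q [q1 dq] Qq] := infinite_nat_unbounded (maxn Q q0) wx.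
  move: Qq; rewrite geq_max => /andP[Qq qq0]; exists q; split=> //.
  have [||p hp] := @dist_int_lt_cap R _ _ _ (delta q) dq; first exact: d0.
    by rewrite le_max lexx.
  have [_ /(_ x (lsubmx p) (rsubmx p) Ox) ps] := Hs0 q qq0.
  have hl i : `|q%:R * x 0 i - th1 0 i - (lsubmx p 0 i)%:~R| < delta q.
    rewrite -[x 0 i](row_mxEl x (f x)).
    by have := hp (lshift m i); rewrite !mxE.
  have hr l : `|q%:R * f x 0 l - th2 0 l - (rsubmx p 0 l)%:~R| < delta q.
    rewrite -[f x 0 l](row_mxEr x (f x)).
    by have := hp (rshift d l); rewrite !mxE.
  have {}ps := ps hl hr.
  have [/(_ x hl)[j _ Pj] PN _] := HP (q, lsubmx p) qq0.
  have jN : (j < N)%N.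
    by rewrite ltnNge; apply/negP => /PN P0; rewrite P0 in Pj.
  have inL : (lsubmx p, j) \in L q.
    by apply: allpairs_f; rewrite ?mem_iota// /s qq0.
  exists (index (lsubmx p, j) (L q)); first by rewrite size_map index_mem.
  by rewrite (nth_map (lsubmx p, j)) ?index_mem// nth_index.
- move=> q; case: ifP => // qq; rewrite divr_gt0// ltr0n.
  exact: leq_trans qq.
- move=> q j; rewrite size_map => jL.
  have [qq|qq] := leqP q0 q; last first.
    by move: jL; rewrite /L /s (ltn_geF qq).
  have p0 : 'rV[int]_d * nat by exact: (0, 0%N).
  by rewrite (nth_map p0)//; have [_ _] := HP (q, (nth p0 (L q) j).1) qq; apply.
- apply/cvgrPdist_le => e e0.
  near=> q.
  have q1 : (maxn q0 (Num.truncn e^-1).+1 <= q)%N by near: q; exact: nbhs_infty_ge.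
  move: q1; rewrite geq_max => /andP[qq qe']; rewrite qq sub0r normrN.
  have qR : 0 < q%:R :> R by rewrite ltr0n (leq_trans _ qq).
  rewrite ger0_norm; last by rewrite divr_ge0// ltW.
  rewrite ler_pdivrMr//; apply: le_trans (d1 q) _.
  rewrite mulrC -ler_pdivrMr// div1r.
  have ei0 : 0 <= e^-1 by rewrite invr_ge0 ltW.
  have /andP[_ h] := truncn_itv ei0.
  by apply: le_trans (ltW h) _; rewrite ler_nat.
- apply: (@gauge_sum_le R d m g psi phi delta (fun q => size [seq W q pj | pj <- L q])
    (N%:R * K) q0) => //.
  + by rewrite mulr_ge0// ltW.
  + by move=> q; exact: ltW.
  + by move=> q; rewrite /delta /Order.max; case: ifP => _; [right|left]; rewrite ge_min lexx.
  + by move=> q qq; rewrite size_map /L /s (ltn_geF qq).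
  + move=> q qq; rewrite size_map size_allpairs size_iota /s qq natrM mulrC.
    rewrite -!mulrA ler_wpM2l// !mulrA; exact: (Hs0 q qq).1.
Unshelve. all: by end_near. Qed.

(** Every neighbourhood of x contains a cube through x from a countable family; side 2 / (N + 1) <=
    r is ensured by N + 1 > 2 / r. *)
Lemma grid_cube (R : realType) d (x : 'rV[R]_d) (r : R) : 0 < r ->
  exists (N : nat) (z : 'rV[int]_d),
    (forall i, `|x 0 i - (z 0 i)%:~R / N.+1%:R| <= N.+1%:R^-1) /\
    forall y : 'rV[R]_d, (forall i, `|y 0 i - (z 0 i)%:~R / N.+1%:R| <= N.+1%:R^-1) ->
      `|y - x| <= r.
Proof.
move=> r0; pose N := Num.truncn (2 / r).
have N0 : 0 < N.+1%:R :> R by rewrite ltr0n.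
have Nr : 2 * N.+1%:R^-1 <= r.
  have r2 : 0 <= 2 / r by rewrite divr_ge0// ltW.
  have /andP[_ /ltW] := truncn_itv r2; rewrite -/N ler_pdivrMr// => h.
  by rewrite ler_pdivrMr// mulrC.
have zx i : `|x 0 i - (Num.floor (N.+1%:R * x 0 i))%:~R / N.+1%:R| <= N.+1%:R^-1.
  have /andP[h1 h2] := floor_itv (N.+1%:R * x 0 i); rewrite intrD in h2.
  rewrite -[leRHS]mul1r ler_pdivlMr//.
  have -> : `|x 0 i - (Num.floor (N.+1%:R * x 0 i))%:~R / N.+1%:R| * N.+1%:R =
    `|N.+1%:R * x 0 i - (Num.floor (N.+1%:R * x 0 i))%:~R|.
    rewrite -[X in _ * X = _](gtr0_norm N0) -normrM mulrBl mulfVK ?gt_eqF//.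
    by rewrite [x 0 i * _]mulrC.
  by rewrite ger0_norm ?subr_ge0//; lra.
exists N, (\row_i Num.floor (N.+1%:R * x 0 i)); split=> [i|y hy].
  by rewrite mxE zx.
apply: le_trans Nr; apply/rV_norm_leP => [|i].
  by rewrite mulr_ge0// invr_ge0 ltW.
have := hy i; have := zx i; rewrite !mxE; set v := _^-1.
by rewrite !ler_norml => /andP[? ?] /andP[? ?]; apply/andP; split; lra.
Qed.

Lemma graph_lipschitz (R : realType) (d m : nat) (a b : 'rV[R]_d)
    (f : 'rV[R]_d -> 'rV[R]_m) : C2_map (rectangle a b) f ->
  exists2 M : nat, (0 < M)%N & forall x y, rectangle a b x -> rectangle a b y ->
    `|row_mx x (f x) - row_mx y (f y)| <= M%:R * `|x - y|.
Proof.
move=> fC; have [C C0 [_ B2 _]] := C2_map_bounds fC.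
exists (Num.truncn C).+2 => // x y Kx Ky.
have /andP[_ h] := truncn_itv (ltW C0).
have CM : C <= (Num.truncn C).+2%:R by apply: le_trans (ltW h) _; rewrite ler_nat.
apply/rV_norm_leP => [|i]; first by rewrite mulr_ge0.
rewrite mxE [(- row_mx _ _) _ _]mxE; case: (split_ordP i) => j ->.
  rewrite !row_mxEl -[leLHS]mul1r ler_pM// ?ler1n//.
  by have := coord_le_norm (x - y) j; rewrite !mxE.
by rewrite !row_mxEr; apply: le_trans (B2 x y j Kx Ky) _; rewrite ler_wpM2r.
Qed.

Theorem theorem2p1 (R : realType) (d m : nat) (hd : (0 < d)%N) (hm : (0 < m)%N)
  (a b : 'rV[R]_d) (hab : forall i, a 0 i < b 0 i)
  (f : 'rV[R]_d -> 'rV[R]_m) (hf : C2_map (rectangle a b) f)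
  (g : R -> R) (hg : dimension_function g)
  (hgbar : {in `]0, +oo[ &, {homo gbar m g : x y / x <= y}})
  (k : nat) (hk : (0 < k)%N)
  (hI : (\sum_(1 <= q <oo)
           (q%:R ^+ (d + m) *
            g (q%:R^-1 * (q%:R^-1 * ln q%:R ^+ 2)
                           `^ (k%:R / (2 * m + k)%:R)))%:E < +oo)%E)
  (hII : hausdorff_measure (gbar m g)
           [set x | rectangle a b x /\
              ~ (forall t : 'rV[R]_m, t != 0 ->
                   (k <= \rank (\matrix_(i, j)
                       dot t (second_deriv (rectangle a b) f x i j)))%N)] = 0%E) :
  strong_jarnik_convergence m g (graph_on (rectangle a b) f).
Proof.
move=> psi psi_gt0 psi_sum theta.
have hh := gbar_monotone_gauge hm hg hgbar.
apply/hausdorff_measure_eq0 => //; move/(hausdorff_measure_eq0 _ hh) in hII.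
(* The value at 0 is unconstrained and enters neither the series nor the limsup set; replacing it
   gives positivity for all q. *)
pose psi1 q := if (0 < q)%N then psi q else 1.
have psi1_gt0 q : 0 < psi1 q by rewrite /psi1; case: ifP => // /psi_gt0.
have sum1 (u v : nat -> R) : (forall q, (0 < q)%N -> u q = v q) ->
    (\sum_(1 <= q <oo) (u q)%:E = \sum_(1 <= q <oo) (v q)%:E)%E.
  move=> uv; apply/congr_lim/funext => n.
  by apply: eq_big_nat => q /andP[q1 _]; rewrite uv.
have psi1_sum : (\sum_(1 <= q <oo) (q%:R ^+ (d + m) * g (psi1 q / q%:R))%:E < +oo)%E.
  rewrite (_ : (\sum_(1 <= q <oo) _)%E = (\sum_(1 <= q <oo)
    (q%:R ^+ (d + m) * g (psi q / q%:R))%:E)%E)//.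
  by apply: sum1 => q q0; rewrite /psi1 q0.
have phi_sum : (\sum_(1 <= q <oo) (q%:R ^+ (d + m) *
    g ((q%:R^-1 * ln q%:R ^+ 2) `^ (k%:R / (2 * m + k)%:R) / q%:R))%:E < +oo)%E.
  rewrite (_ : (\sum_(1 <= q <oo) _)%E = (\sum_(1 <= q <oo) (q%:R ^+ (d + m) *
            g (q%:R^-1 * (q%:R^-1 * ln q%:R ^+ 2)
                           `^ (k%:R / (2 * m + k)%:R)))%:E)%E)//.
  by apply: sum1 => q q0; rewrite [_ / q%:R]mulrC.
have psi1E : well_approximable psi theta = well_approximable psi1 theta.
  apply/funext => x; rewrite /well_approximable; congr (infinite_set _).
  apply/seteqP; split=> q [q0]; rewrite /psi1 /= q0.
    by split.
  by split.
have [M M0 FM] := graph_lipschitz hf.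
pose K := rectangle a b.
pose E := [set x | well_approximable psi1 theta (row_mx x (f x))].
(* The graph map is Lipschitz on K, so it suffices to treat the set of parameters alpha. *)
apply: (@gauge_null_sub _ _ _ _ ((fun x => row_mx x (f x)) @` (K `&` E))).
  move=> z [wz [x Kx xz]]; exists x => //; split=> //.
  by rewrite /E /= xz -psi1E.
apply: gauge_null_lipschitz M0 _ _ => //.
  by move=> x y [Kx _] [Ky _]; exact: FM.
pose local Om := exists x0 Lam, [/\ 0 < Lam, forall x, Om x -> `|x - x0| <= 1 &
  forall t : 'rV[R]_m, t != 0 -> exists I J : 'I_k -> 'I_d, injective J /\
    forall x y, Om x -> Om y -> forall Y Z : R, 0 <= Y -> 0 <= Z ->
    (forall i, `|grad_dot a b f t (I i) x - grad_dot a b f t (I i) y| <= `|t| * Y) ->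
    (forall l, (forall i, J i != l) -> `|x 0 l - y 0 l| <= Z) ->
    `|x - y| <= Lam * (Y + Z)].
pose cube (Nz : nat * 'rV[int]_d) : set 'rV[R]_d := K `&`
  [set x | forall i, `|x 0 i - (Nz.2 0 i)%:~R / Nz.1.+1%:R| <= Nz.1.+1%:R^-1].
(* Enumerates the cubes and keeps those with an expansion constant for all t. Every point of [K]
   satisfying the rank condition lies in such a cube; the other points form the null set of (II). *)
pose A n := if unpickle n is Some Nz then
  if `[< local (cube Nz) >] then cube Nz `&` E else set0 else set0.
apply: gauge_null_sub (gauge_null_setU hh hII (@gauge_null_bigcup _ _ _ A hh _)).
  move=> x [Kx Ex]; have [rk|] := pselect (forall t : 'rV[R]_m, t != 0 ->
    (k <= \rank (\matrix_(i, j) dot t (second_deriv K f x i j)))%N); last by left.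
  right; have [r r0 Hr] := expands_locally hf Kx rk.
  have rm0 : 0 < Num.min r 1 by rewrite lt_min r0 ltr01.
  have [N [z [xz zb]]] := grid_cube x rm0.
  exists (pickle (N, z)) => //; rewrite /A pickleK asboolT; first by split.
  exists x, r^-1; split; first by rewrite invr_gt0.
    by move=> y [_ /zb]; rewrite le_min => /andP[].
  move=> t tN; have [I [J [Jinj H]]] := Hr t tN.
  exists I, J; split=> // y y' [Ky /zb hy] [Ky' /zb hy'].
  by move: hy hy'; rewrite !le_min => /andP[hy _] /andP[hy' _]; exact: H.
move=> n; rewrite /A; case: (unpickle n) => [Nz|]; last first.
  exact: gauge_null0.
case: asboolP => [[x0 [Lam [Lam0 hx0 H]]]|_]; last first.
  exact: gauge_null0.
have cubeK : cube Nz `<=` rectangle a b by move=> x [].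
exact: (@local_null R d m k a b f g psi1 theta (cube Nz) x0 Lam hm hk hf hg hgbar
  psi1_gt0 psi1_sum phi_sum cubeK hx0 Lam0 H).
Qed.
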